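(* Let $M$ be a $C^{1,1}$-manifold and let $\nabla$ be a tame connection on $TM$, satisfying the lower bound assumption (LB) for some nonnegative measure, with Ricci measure $\mathcal{R}$. Let $\{T^{(r)}\}_{r=1}^\infty$ be a sequence of measurable $(1,2)$-tensor fields on $M$, symmetric in the lower two indices, such that for every $r$ and every Lipschitz vector field $v$, $T^{(r)}(v)=\sum_k (T^{(r)})^i_{\ jk}v^k$ is a locally bounded section of $\operatorname{End}(TM)$. Suppose that the connections $\{\nabla+T^{(r)}\}_{r=1}^\infty$ satisfy (LB) with a uniform choice of $h$ (one $h$ for all $r$). Let $\mathcal{R}^{(r)}$ be the Ricci measure of $\nabla+T^{(r)}$. Suppose that for each compactly supported Lipschitz vector field $v$, $\lim_{r\to\infty}T^{(r)}(v)=0$ in $L^\infty(M;\operatorname{End}(TM))$. Then $\lim_{r\to\infty}\mathcal{R}^{(r)}=\mathcal{R}$ in the weak-$*$ topology on $\mathcal{M}(M;S^2(T^*M)\otimes\mathcal{D}^* )$.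
   Context: A $C^{1,1}$-manifold is a manifold with a (maximal) atlas whose transition maps have Lipschitz first derivatives; let $n=\dim M$. $\mathcal{D}^c$ is the line bundle of $c$-densities, associated to the frame bundle via $A\mapsto|\det A|^{-c}$, and $\mathcal{D}=\mathcal{D}^1$; the product of two half-densities is a density, and compactly supported densities can be integrated. A connection here means a measurable torsion-free connection: an $\mathbb{R}$-bilinear map $\nabla$ from pairs of Lipschitz vector fields to measurable vector fields with $\nabla_{fX}Y=f\nabla_XY$, $\nabla_X(fY)=(Xf)Y+f\nabla_XY$ and $\nabla_XY-\nabla_YX=[X,Y]$ for Lipschitz $f,X,Y$; its Christoffel symbols are given by $\nabla_{\partial_i}\partial_j=\sum_k\Gamma^k_{\ ji}\partial_k$; $\nabla+T$ has Christoffel symbols $\Gamma^i_{\ jk}+T^i_{\ jk}$. A Lipschitz vector-valued half-density is a Lipschitz section of $TM\otimes\mathcal{D}^{1/2}$; locally $V=\sum_jv^j\partial_j\otimes\sqrt{dx^1\cdots dx^n}$, and $\nabla_iV^j=(\nabla_iv^j)\sqrt{dx^1\cdots dx^n}$ with $\nabla_iv^j=\partial_iv^j+\sum_k\Gamma^j_{\ ki}v^k-\frac12\sum_k\Gamma^k_{\ ki}v^j$. For compactly supported Lipschitz vector-valued half-densities, $$Q(V,W)=\int_M\sum_{i,j}\big[(\nabla_iV^i)(\nabla_jW^j)-(\nabla_iV^j)(\nabla_jW^i)\big].$$ The connection is tame if the integrand (a density) is integrable for all such $V,W$. (Under the stated hypothesis on $T^{(r)}$, each $\nabla+T^{(r)}$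 is tame.) For a continuous vector bundle $E$, $\mathcal{M}(M;E)$ is the dual space of the topological vector space of compactly supported continuous sections of $E^*$. For $h\in\mathcal{M}(M;S^2(T^*M)\otimes\mathcal{D}^* )$, $\int_M\langle V,hW\rangle$ is the pairing of $h$ with the symmetrization of $V\otimes W$; $h$ is nonnegative if it pairs nonnegatively with pointwise nonnegative compactly supported continuous sections of $S^2(TM)\otimes\mathcal{D}$. (LB): there is a nonnegative $h\in\mathcal{M}(M;S^2(T^*M)\otimes\mathcal{D}^* )$ such that $Q(V,V)\ge-\int_M\langle V,hV\rangle$ for all compactly supported Lipschitz vector-valued half-densities $V$. If a tame connection satisfies (LB), its Ricci measure is the element $\mathcal{R}\in\mathcal{M}(M;S^2(T^*M)\otimes\mathcal{D}^* )$ with $Q(V,W)=\int_M\langle V,\mathcal{R}W\rangle$ for all compactly supported Lipschitz vector-valued half-densities $V,W$ (it exists). *)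

(* Defs.v *)
From mathcomp Require Import all_boot all_order all_algebra.
From mathcomp Require Import all_classical all_reals all_analysis.
Set Implicit Arguments.
Unset Strict Implicit.
Unset Printing Implicit Defensive.
Import Order.TTheory GRing.Theory Num.Theory.
Import numFieldNormedType.Exports.
Local Open Scope classical_set_scope.
Local Open Scope ring_scope.

Section lebesgue.
Variable R : realType.

Definition tuple_cons (n : nat)
    (p : measurableTypeR R * n.-tuple (measurableTypeR R)) :
    n.+1.-tuple (measurableTypeR R) :=
  [tuple of p.1 :: p.2].

(* The library has no Lebesgue measure on R^n: it is built here as an iterated
   product, on n.-tuple R, which carries the product sigma-algebra. *)
Fixpoint lebesgue_n (n : nat) : set (n.-tuple (measurableTypeR R)) -> \bar R :=
  if n is n'.+1
  then pushforward (lebesgue_measure \x @lebesgue_n n')%E (@tuple_cons n')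
  else dirac ([tuple] : 0.-tuple (measurableTypeR R)).

(* Derivatives and topology live on 'rV[R]_n, measure theory on n.-tuple R. *)
Definition row_of (n : nat) (t : n.-tuple (measurableTypeR R)) : 'rV[R]_n :=
  \row_j tnth t j.

End lebesgue.

Section manifold.
Variables (R : realType) (n : nat).

Definition locally_lipschitz (V W : normedModType R) (D : set V) (f : V -> W) :=
  forall x, D x ->
    exists2 U : set V, nbhs x U & [lipschitz f y | y in U `&` D].

Record chart (M : topologicalType) := Chart {
  chart_dom : set M ;
  chart_coord : M -> 'rV[R]_n ;
  chart_param : 'rV[R]_n -> M ;
  dom_open : open chart_dom ;
  coord_open : open (chart_coord @` chart_dom) ;
  coordK : forall x, chart_dom x -> chart_param (chart_coord x) = x ;
  coord_continuous : {within chart_dom, continuous chart_coord} ;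
  param_continuous : {within chart_coord @` chart_dom, continuous chart_param} }.

Definition transition (M : topologicalType) (c d : chart M) :
  'rV[R]_n -> 'rV[R]_n := chart_coord d \o chart_param c.

Definition C11_on (D : set 'rV[R]_n) (f : 'rV[R]_n -> 'rV[R]_n) :=
  (forall y, D y -> differentiable f y) /\
  locally_lipschitz D (fun y => 'J f y).

Definition C11_compatible (M : topologicalType) (c d : chart M) :=
  C11_on (chart_coord c @` (chart_dom c `&` chart_dom d)) (transition c d) /\
  C11_on (chart_coord d @` (chart_dom c `&` chart_dom d)) (transition d c).

Record C11_manifold := C11Manifold {
  carrier :> topologicalType ;
  chart_index : Type ;
  atlas : chart_index -> chart carrier ;
  carrier_hausdorff : hausdorff_space carrier ;
  carrier_second_countable : @second_countable carrier ;
  atlas_cover : forall x, exists c, chart_dom (atlas c) x ;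
  atlas_compatible : forall c d, C11_compatible (atlas c) (atlas d) ;
  atlas_maximal : forall k : chart carrier,
    (forall c, C11_compatible k (atlas c)) -> exists c, atlas c = k }.

End manifold.

Section fields.
Variables (R : realType) (n : nat) (M : C11_manifold R n).

Local Notation dom_ c := (chart_dom (atlas c)).
Local Notation coord_ c := (chart_coord (atlas c)).
Local Notation param_ c := (chart_param (atlas c)).

(* A section of a bundle associated to the frame bundle, with fibre model F, is
   given by its components s c x : F at x in each chart c.  With row vectors,
   u *m jac c d x are the components in d of the tangent vector of components u
   in c; [act J] is the induced change of components in F.  Components outside
   the domain of a chart are set to 0, so that sections are extensional. *)
Definition components (F : Type) := chart_index M -> M -> F.

Definition jac (c d : chart_index M) (x : M) : 'M[R]_n :=
  'J (transition (atlas c) (atlas d)) (coord_ c x).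

Definition is_section (F : nmodType) (act : 'M[R]_n -> F -> F)
    (s : components F) :=
  (forall c x, ~ dom_ c x -> s c x = 0) /\
  (forall c d x, dom_ c x -> dom_ d x ->
     s d x = act (jac c d x) (s c x)).

Definition tangent_act (J : 'M[R]_n) (u : 'rV[R]_n) : 'rV[R]_n := u *m J.

Definition density_act (p : R) (J : 'M[R]_n) : R := `|\det J| `^ (- p).

Definition half_density_vector_act (J : 'M[R]_n) (u : 'rV[R]_n) : 'rV[R]_n :=
  density_act 2^-1 J *: tangent_act J u.

(* S^2(TM) (x) D^1 *)
Definition sym2_density_act (J A : 'M[R]_n) : 'M[R]_n :=
  density_act 1 J *: (J^T *m A *m J).

(* The component T^i_{jk} of a (1,2)-tensor t is t i j k. *)
Definition tensor12 := {ffun 'I_n -> 'M[R]_n}.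

Definition tensor12_act (J : 'M[R]_n) (t : tensor12) : tensor12 :=
  [ffun i => \sum_p J p i *: (invmx J *m t p *m (invmx J)^T)].

Definition compact_support (F : nmodType) (s : components F) :=
  compact (closure [set x | exists2 c, dom_ c x & s c x <> 0]).

Definition lipschitz_function (f : M -> R) :=
  forall c, locally_lipschitz (coord_ c @` dom_ c)
              (f \o param_ c).

Definition lipschitz_components (F : normedModType R) (s : components F) :=
  forall c, locally_lipschitz (coord_ c @` dom_ c)
              (s c \o param_ c).

Definition in_chart (c : chart_index M) (A : set M) :
    set (n.-tuple (measurableTypeR R)) :=
  @row_of R n @^-1` (coord_ c @` (dom_ c `&` A)).

Definition chart_measurable (c : chart_index M) (f : M -> R) :=
  measurable_fun (in_chart c setT) (f \o param_ c \o @row_of R n).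

Definition chart_negligible (c : chart_index M) (A : set M) :=
  (@lebesgue_n R n).-negligible (in_chart c A).

Definition ae_eq_components (F : Type) (s t : components F) :=
  forall c, chart_negligible c [set x | s c x <> t c x].

Definition lipschitz_vector_field (X : components 'rV[R]_n) :=
  is_section tangent_act X /\ lipschitz_components X.

Definition measurable_vector_field (X : components 'rV[R]_n) :=
  is_section tangent_act X /\
  (forall c j, chart_measurable c (fun x => X c x 0 j)).

(* Partial derivative in the chart c; it exists almost everywhere when f is
   locally Lipschitz. *)
Definition pderiv (c : chart_index M) (i : 'I_n) (f : M -> R) (x : M) : R :=
  'D_(delta_mx 0 i) (f \o param_ c) (coord_ c x).

Definition dir_deriv (X : components 'rV[R]_n) (c : chart_index M) (f : M -> R)
    (x : M) : R :=
  \sum_i X c x 0 i * pderiv c i f x.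

Definition lie_bracket (X Y : components 'rV[R]_n) : components 'rV[R]_n :=
  fun c x => \row_k (dir_deriv X c (fun z => Y c z 0 k) x -
                     dir_deriv Y c (fun z => X c z 0 k) x).

Definition lincomb (F : lmodType R) (a : R) (s t : components F) :
  components F := fun c x => a *: s c x + t c x.

Definition fun_scale (f : M -> R) (X : components 'rV[R]_n) :
  components 'rV[R]_n := fun c x => f x *: X c x.

(* Connections; measurable vector fields are identified when they agree almost
   everywhere, and only the values on Lipschitz vector fields are relevant. *)

Definition connection_map :=
  components 'rV[R]_n -> components 'rV[R]_n -> components 'rV[R]_n.

Record is_connection (D : connection_map) : Prop := IsConnection {
  connection_measurable : forall X Y,
    lipschitz_vector_field X -> lipschitz_vector_field Y ->
    measurable_vector_field (D X Y) ;
  connection_linear_l : forall a X X' Y,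
    lipschitz_vector_field X -> lipschitz_vector_field X' ->
    lipschitz_vector_field Y ->
    ae_eq_components (D (lincomb a X X') Y) (lincomb a (D X Y) (D X' Y)) ;
  connection_linear_r : forall a X Y Y',
    lipschitz_vector_field X -> lipschitz_vector_field Y ->
    lipschitz_vector_field Y' ->
    ae_eq_components (D X (lincomb a Y Y')) (lincomb a (D X Y) (D X Y')) ;
  connection_tensorial : forall f X Y,
    lipschitz_function f ->
    lipschitz_vector_field X -> lipschitz_vector_field Y ->
    ae_eq_components (D (fun_scale f X) Y) (fun_scale f (D X Y)) ;
  connection_leibniz : forall f X Y,
    lipschitz_function f ->
    lipschitz_vector_field X -> lipschitz_vector_field Y ->
    ae_eq_components (D X (fun_scale f Y))
      (fun c x => dir_deriv X c f x *: Y c x + f x *: D X Y c x) ;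
  connection_torsion_free : forall X Y,
    lipschitz_vector_field X -> lipschitz_vector_field Y ->
    ae_eq_components (lincomb (-1) (D Y X) (D X Y)) (lie_bracket X Y) }.

(* G c x k j i is Gamma^k_{ji} in the chart c.  The coordinate fields of c are
   not globally defined, so the defining relation
   D_{d_i} d_j = sum_k Gamma^k_{ji} d_k is tested, on each open subset O of the
   domain, on Lipschitz vector fields equal to d_i and d_j on O. *)
Definition is_christoffel (D : connection_map) (G : components tensor12) :=
  (forall c k j i, chart_measurable c (fun x => G c x k j i)) /\
  (forall c (O : set M) X Y i j, open O -> O `<=` dom_ c ->
     lipschitz_vector_field X -> lipschitz_vector_field Y ->
     (forall x, O x -> X c x = delta_mx 0 i) ->
     (forall x, O x -> Y c x = delta_mx 0 j) ->
     forall k,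
       chart_negligible c [set x | O x /\ D X Y c x 0 k <> G c x k j i]).

(* They are unique up to null sets. *)
Definition christoffel (D : connection_map) : components tensor12 :=
  xget (fun _ _ => 0) [set G | is_christoffel D G].

(* T^i_{jk} is added to Gamma^i_{jk}, the coefficient of d_i in D_{d_k} d_j. *)
Definition add_tensor (D : connection_map) (T : components tensor12) :
    connection_map :=
  fun X Y c x => D X Y c x +
    \row_i \sum_j \sum_k T c x i j k * Y c x 0 j * X c x 0 k.

(* T(v)^i_j = sum_k T^i_{jk} v^k *)
Definition tensor_apply (T : components tensor12) (v : components 'rV[R]_n) :
    components 'M[R]_n :=
  fun c x => \matrix_(i, j) \sum_k T c x i j k * v c x 0 k.

Definition measurable_symmetric_tensor (T : components tensor12) :=
  [/\ is_section tensor12_act T,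
      forall c i j k, chart_measurable c (fun x => T c x i j k) &
      forall c x i j k, T c x i j k = T c x i k j].

Definition locally_bounded_components (A : components 'M[R]_n) :=
  forall c (K : set M), compact K -> K `<=` dom_ c ->
    exists C : R, chart_negligible c
      [set x | K x /\ exists i j, C < `|A c x i j|].

(* Convergence to 0 in L^oo of sections whose supports lie in a common compact
   set: on compact sets all norms on the fibres are equivalent. *)
Definition Linfty_cvg0 (A : nat -> components 'M[R]_n) :=
  forall c (K : set M), compact K -> K `<=` dom_ c ->
    forall e : R, 0 < e -> \forall r \near \oo, chart_negligible c
      [set x | K x /\ exists i j, e < `|A r c x i j|].

(* Countably many compact sets, each inside a chart, whose interiors cover M.
   The disjoint Borel pieces [seqDU K k] then form a locally finite partition
   of M. *)
Definition chart_cover (cK : (nat -> chart_index M) * (nat -> set M)) :=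
  (forall k, compact (cK.2 k) /\ cK.2 k `<=` dom_ (cK.1 k)) /\
  (forall x, exists k, (cK.2 k)° x).

Definition density_integral_on (cK : (nat -> chart_index M) * (nat -> set M))
    (w : components R) : \bar R :=
  (\sum_(0 <= k <oo)
    \int[@lebesgue_n R n]_(t in in_chart (cK.1 k) (seqDU cK.2 k))
      (w (cK.1 k) (param_ (cK.1 k) (row_of t)))%:E)%E.

(* By the change of variables formula the value does not depend on the cover;
   a cover exists unless M is empty. *)
Definition density_integral (w : components R) : \bar R :=
  if pselect (exists cK, chart_cover cK) is left h
  then density_integral_on (projT1 (cid h)) w else 0%E.

Definition density_integrable (w : components R) :=
  forall cK, chart_cover cK ->
    (forall k, (@lebesgue_n R n).-integrable
       (in_chart (cK.1 k) (seqDU cK.2 k))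
       (fun t => (w (cK.1 k) (param_ (cK.1 k) (row_of t)))%:E)) /\
    (density_integral_on cK (fun c x => `|w c x|%R) < +oo)%E.

Definition lipschitz_half_density (V : components 'rV[R]_n) :=
  [/\ is_section half_density_vector_act V, lipschitz_components V &
      compact_support V].

(* nabla_i v^j *)
Definition cov_deriv (G : components tensor12) (V : components 'rV[R]_n)
    (c : chart_index M) (x : M) (i j : 'I_n) : R :=
  pderiv c i (fun z => V c z 0 j) x + \sum_k G c x j k i * V c x 0 k
    - 2^-1 * (\sum_k G c x k k i) * V c x 0 j.

Definition Q_density (D : connection_map) (V W : components 'rV[R]_n) :
    components R :=
  fun c x => let d := cov_deriv (christoffel D) in
    \sum_i \sum_j (d V c x i i * d W c x j j - d V c x i j * d W c x j i).

Definition Q_form (D : connection_map) (V W : components 'rV[R]_n) : \bar R :=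
  density_integral (Q_density D V W).

Definition tame (D : connection_map) :=
  forall V W, lipschitz_half_density V -> lipschitz_half_density W ->
    density_integrable (Q_density D V W).

(* Continuous compactly supported sections of S^2(TM) (x) D^1. *)
Definition test_section (s : components 'M[R]_n) :=
  [/\ is_section sym2_density_act s,
      forall c x, (s c x)^T = s c x,
      forall c, {within dom_ c, continuous (s c)} &
      compact_support s].

(* Continuous linear forms on the locally convex inductive limit, over compact
   sets K, of the spaces of test sections supported in K with the topology of
   uniform convergence; the latter is generated by the sup norms of components
   over compact subsets of charts. *)
Definition is_measure (mu : components 'M[R]_n -> R) :=
  (forall a s t, test_section s -> test_section t ->
     mu (lincomb a s t) = a * mu s + mu t) /\
  (forall K : set M, compact K ->
     exists (N : nat) (c : 'I_N -> chart_index M) (L : 'I_N -> set M) (C : R),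
       (forall m, compact (L m) /\ L m `<=` dom_ (c m)) /\
       (forall s (e : R), test_section s ->
          (forall d x, ~ K x -> s d x = 0) ->
          0 <= e ->
          (forall m x i j, L m x -> `|s (c m) x i j| <= e) ->
          `|mu s| <= C * e)).

Definition nonneg_section (s : components 'M[R]_n) :=
  forall c x (xi : 'rV[R]_n), dom_ c x ->
    0 <= (xi *m s c x *m xi^T) 0 0.

Definition nonneg_measure (mu : components 'M[R]_n -> R) :=
  is_measure mu /\
  (forall s, test_section s -> nonneg_section s -> 0 <= mu s).

(* The symmetrization of V (x) W. *)
Definition sym_prod (V W : components 'rV[R]_n) : components 'M[R]_n :=
  fun c x => \matrix_(i, j)
    (2^-1 * (V c x 0 i * W c x 0 j + V c x 0 j * W c x 0 i)).

Definition satisfies_LB (D : connection_map) (h : components 'M[R]_n -> R) :=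
  forall V, lipschitz_half_density V ->
    ((- h (sym_prod V V))%:E <= Q_form D V V)%E.

Definition ricci_measure (D : connection_map) (Ric : components 'M[R]_n -> R) :=
  is_measure Ric /\
  (forall V W, lipschitz_half_density V -> lipschitz_half_density W ->
     Q_form D V W = (Ric (sym_prod V W))%:E).

Definition weak_star_cvg (mu : nat -> components 'M[R]_n -> R)
    (nu : components 'M[R]_n -> R) :=
  forall s, test_section s -> (fun r => mu r s) @ \oo --> nu s.

End fields.

(* Main.v *)
Require Import Defs.
From HB Require Import structures.
From mathcomp Require Import all_boot all_order all_algebra.
From mathcomp Require Import all_classical all_reals all_analysis.
From mathcomp Require Import measurable_realfun.
From mathcomp Require Import ring lra.
Import Order.TTheory GRing.Theory Num.Theory.
Import numFieldNormedType.Exports.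
Local Open Scope classical_set_scope.
Local Open Scope ring_scope.

(** The theorem splits into two independent facts: the forms Q of the perturbed
connections converge to Q on every pair of Lipschitz half-densities, and a
sequence of measures with a common lower bound that converges on all products
of Lipschitz half-densities converges weakly.

Convergence of Q. The integrand of Q is q(A, B) = tr A tr B - tr (A B) at the
covariant derivatives A and B of the two half-densities. Adding T^(r) to the
connection changes A by an expression that is linear in T^(r) and in the
half-density, without derivatives, and so tends to 0 uniformly on compact sets;
testing the hypothesis on coordinate fields cut off near a point shows that all
components of T^(r) do ([tensor_uniform_cvg0], [christoffel_uniform_cvg]). Hence
Q converges as soon as A and B are locally integrable ([Q_piece_cvg]). Tameness
only says that q(A, B) is integrable, but it says so for all pairs V, W of
half-densities: if A is the covariant derivative of V, then, for a coordinate
field W and a coordinate function f, the difference between the integrand at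
f W and f times the integrand at W is the value of q at A and the product of df
with W, a matrix with a single nonzero entry. This shows that
delta_ab tr A - A_ab is locally integrable for all a and b, and for n >= 2 this
gives all the entries of A ([cov_deriv_integrable_combination],
[cov_deriv_integrable]). For n <= 1 the form q vanishes.

Weak convergence. By (LB) the functionals mu_r = Ric^(r) + h are nonnegative on
the squares of Lipschitz half-densities. Let eta be a cutoff equal to 1 on the
support of a Lipschitz function g with |g| <= 1. Nonnegativity on the squares
of eta e_i + g e_j and eta e_i - g e_j bounds mu_r (g e_i e_j) by the
values of mu_r on the sections eta^2 e_k e_k ([positive_diag_bound],
[positive_cross_bound]), which converge and so are bounded in r. A section that
is uniformly small and supported in a small ball is therefore small for all
mu_r together ([positive_bound]); approximating a continuous section by
Lipschitz ones, one passes from products of half-densities to arbitrary test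
sections, first inside one chart ([weak_cvg_local]) and then, by cutoffs, on the
whole manifold ([weak_cvg_global]). *)

Set Implicit Arguments.
Unset Strict Implicit.
Unset Printing Implicit Defensive.

(** * Locally Lipschitz maps between normed spaces *)

(** A pointwise notion, so that the calculus below needs no bookkeeping of
domains; on an open set it amounts to [locally_lipschitz], see
[locally_lipschitz_loclip]. *)
Definition loclip (R : realType) (V W : normedModType R) (f : V -> W) (x : V) :=
  exists2 k : R, 0 < k & exists2 U, nbhs x U &
    forall y z, U y -> U z -> `|f y - f z| <= k * `|y - z|.

Section loclip_calculus.
Variables (R : realType) (V : normedModType R).
Implicit Types (W : normedModType R) (x : V).

Lemma loclip_cst W (a : W) x : loclip (fun=> a) x.
Proof.
exists 1 => //; exists setT; first exact: filterT.
by move=> y z _ _; rewrite subrr normr0 mul1r.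
Qed.

Lemma loclip_id x : loclip id x.
Proof.
exists 1 => //; exists setT; first exact: filterT.
by move=> y z _ _; rewrite mul1r.
Qed.

Lemma loclip_near_eq W (f g : V -> W) x :
  (\near x, f x = g x) -> loclip f x -> loclip g x.
Proof.
move=> fg [k k0 [U xU kf]]; exists k => //.
exists (U `&` [set y | f y = g y]); first exact: filterI.
by move=> y z [Uy <-] [Uz <-]; exact: kf.
Qed.

Lemma loclip_continuous W (f : V -> W) x : loclip f x -> {for x, continuous f}.
Proof.
move=> [k k0 [U xU kf]]; apply/cvgrPdist_lt => e e0.
near=> y; apply: (@le_lt_trans _ _ (k * `|x - y|)).
  by apply: kf; [exact: nbhs_singleton|near: y].
rewrite mulrC -ltr_pdivlMr//; near: y.
by apply: cvgr_dist_lt; rewrite ?divr_gt0//; exact: cvg_id.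
Unshelve. all: by end_near. Qed.

Lemma loclip_bounded W (f : V -> W) x : loclip f x ->
  exists2 B : R, 0 < B & \near x, `|f x| <= B.
Proof.
move=> /loclip_continuous fx; exists (`|f x| + 1); first exact: ltr_wpDl.
near=> y; rewrite -[f y](subrK (f x)) addrC (le_trans (ler_normD _ _))// lerD2l.
rewrite distrC; near: y; move/cvgrPdist_le : fx; exact.
Unshelve. all: by end_near. Qed.

Lemma loclipD W (f g : V -> W) x :
  loclip f x -> loclip g x -> loclip (fun y => f y + g y) x.
Proof.
move=> [k k0 [U xU kf]] [l l0 [U' xU' lg]].
exists (k + l); first exact: addr_gt0.
exists (U `&` U'); first exact: filterI.
move=> y z [Uy U'y] [Uz U'z].
by rewrite opprD addrACA mulrDl (le_trans (ler_normD _ _))// lerD ?kf ?lg.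
Qed.

Lemma loclip_comp (W W' : normedModType R) (f : V -> W) (g : W -> W') x :
  loclip f x -> loclip g (f x) -> loclip (g \o f) x.
Proof.
move=> fx [l l0 [U' xU' lg]]; have cf := loclip_continuous fx.
case: fx => [k k0 [U xU kf]].
exists (l * k); first exact: mulr_gt0.
exists (U `&` f @^-1` U'); first by apply: filterI => //; exact: cf.
move=> y z [Uy U'y] [Uz U'z] /=.
by rewrite (le_trans (lg _ _ _ _))// -mulrA ler_pM2l ?kf.
Qed.

Lemma loclipZ W (f : V -> R) (g : V -> W) x :
  loclip f x -> loclip g x -> loclip (fun y => f y *: g y) x.
Proof.
move=> fx gx; have [A A0 fA] := loclip_bounded fx.
have [B B0 gB] := loclip_bounded gx.
move: fx gx => [k k0 [U xU kf]] [l l0 [U' xU' lg]].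
exists (k * B + A * l); first by rewrite addr_gt0 ?mulr_gt0.
exists ((U `&` U') `&` ([set y | `|f y| <= A] `&` [set y | `|g y| <= B])).
  by do 2!apply: filterI => //.
move=> y z [[Uy U'y] [_ By]] [[Uz U'z] [Az Bz]].
have -> : f y *: g y - f z *: g z = (f y - f z) *: g y + f z *: (g y - g z).
  by rewrite scalerBl scalerBr addrA subrK.
rewrite (le_trans (ler_normD _ _))// mulrDl !normrZ lerD//.
  by rewrite mulrAC ler_pM ?kf.
by rewrite -mulrA ler_pM ?lg.
Qed.

Lemma loclipN W (f : V -> W) x : loclip f x -> loclip (fun y => - f y) x.
Proof.
move=> fx; apply: (@loclip_near_eq _ (fun y => (-1) *: f y)).
  by near=> y; rewrite scaleN1r.
by apply: loclipZ => //; exact: loclip_cst.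
Unshelve. all: by end_near. Qed.

Lemma loclipB W (f g : V -> W) x :
  loclip f x -> loclip g x -> loclip (fun y => f y - g y) x.
Proof. by move=> fx /loclipN; exact: loclipD. Qed.

Lemma loclipM (f g : V -> R) x :
  loclip f x -> loclip g x -> loclip (fun y => f y * g y) x.
Proof. exact: (@loclipZ R). Qed.

Lemma loclip_sum W (I : Type) (s : seq I) (P : pred I) (f : I -> V -> W) x :
  (forall i, P i -> loclip (f i) x) -> loclip (fun y => \sum_(i <- s | P i) f i y) x.
Proof.
move=> fx; elim: s => [|i s ih].
  apply: (@loclip_near_eq _ (fun=> 0)); last exact: loclip_cst.
  by apply: nearW => y; rewrite big_nil.
have [Pi|Pi] := boolP (P i).
  apply: (@loclip_near_eq _ (fun y => f i y + \sum_(i <- s | P i) f i y)).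
    by apply: nearW => y; rewrite big_cons Pi.
  by apply: loclipD => //; exact: fx.
apply: loclip_near_eq ih.
by apply: nearW => y; rewrite big_cons (negbTE Pi).
Qed.

Lemma loclip_prod (I : Type) (s : seq I) (P : pred I) (f : I -> V -> R) x :
  (forall i, P i -> loclip (f i) x) -> loclip (fun y => \prod_(i <- s | P i) f i y) x.
Proof.
move=> fx; elim: s => [|i s ih].
  apply: (@loclip_near_eq R (fun=> 1)); last exact: loclip_cst.
  by apply: nearW => y; rewrite big_nil.
have [Pi|Pi] := boolP (P i).
  apply: (@loclip_near_eq R (fun y => f i y * \prod_(i <- s | P i) f i y)).
    by apply: nearW => y; rewrite big_cons Pi.
  by apply: loclipM => //; exact: fx.
apply: loclip_near_eq ih.
by apply: nearW => y; rewrite big_cons (negbTE Pi).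
Qed.

Lemma loclip_norm W (f : V -> W) x : loclip f x -> loclip (fun y => `|f y|) x.
Proof.
move=> [k k0 [U xU kf]]; exists k => //; exists U => // y z Uy Uz.
by rewrite (le_trans (ler_dist_dist _ _))// kf.
Qed.

Lemma loclip_inv (f : V -> R) x : loclip f x -> f x != 0 ->
  loclip (fun y => (f y)^-1) x.
Proof.
move=> fx fx0; have cf := loclip_continuous fx.
case: fx => [k k0 [U xU kf]].
have b0 : 0 < `|f x| / 2 by rewrite divr_gt0// normr_gt0.
exists ((`|f x| / 2) ^- 2 * k); first by rewrite mulr_gt0// invr_gt0 exprn_gt0.
exists (U `&` [set y | `|f x| / 2 < `|f y|]).
  apply: filterI => //=; near=> y.
  have : `|f x - f y| < `|f x| / 2 by near: y; move/cvgrPdist_lt : cf; exact.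
  have := ler_normD (f x - f y) (f y); rewrite subrK /=; lra.
move=> y z [Uy /= fy] [Uz /= fz].
have fy0 : f y != 0 by rewrite -normr_gt0 (lt_trans b0).
have fz0 : f z != 0 by rewrite -normr_gt0 (lt_trans b0).
have -> : (f y)^-1 - (f z)^-1 = (f y)^-1 * (f z)^-1 * (f z - f y) by field; exact/andP.
rewrite normrM -[leRHS]mulrA ler_pM//; last by rewrite distrC kf.
rewrite -invfM expr2 normfV lef_pV2 ?posrE ?mulr_gt0 ?normr_gt0 ?mulf_neq0//.
by rewrite normrM ler_pM// ltW.
Unshelve. all: by end_near. Qed.

Lemma loclip_sqrt (f : V -> R) x : loclip f x -> 0 < f x ->
  loclip (fun y => Num.sqrt (f y)) x.
Proof.
move=> fx fx0; have cf := loclip_continuous fx.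
case: fx => [k k0 [U xU kf]].
have b0 : 0 < Num.sqrt (f x / 2) by rewrite sqrtr_gt0 divr_gt0.
exists ((Num.sqrt (f x / 2))^-1 * k); first by rewrite mulr_gt0// invr_gt0.
exists (U `&` [set y | f x / 2 < f y]).
  apply: filterI => //=; near=> y.
  have : `|f x - f y| < f x / 2 by near: y; move/cvgrPdist_lt : cf; apply; rewrite divr_gt0.
  rewrite ltr_norml => /andP[] /=; lra.
move=> y z [Uy /= fy] [Uz /= fz].
have fy0 : 0 < f y by rewrite (lt_trans _ fy)// divr_gt0.
have fz0 : 0 < f z by rewrite (lt_trans _ fz)// divr_gt0.
have s0 : 0 < Num.sqrt (f y) + Num.sqrt (f z) by rewrite addr_gt0// sqrtr_gt0.
have -> : Num.sqrt (f y) - Num.sqrt (f z) =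
    (Num.sqrt (f y) + Num.sqrt (f z))^-1 * (f y - f z).
  rewrite -[X in _ * (X - _)]sqr_sqrtr ?ltW// -[X in _ * (_ - X)]sqr_sqrtr ?ltW//.
  by rewrite subr_sqr mulrCA mulVf ?mulr1 ?gt_eqF.
rewrite normrM -mulrA ler_pM ?kf// gtr0_norm ?invr_gt0// lef_pV2 ?posrE//.
by rewrite (@le_trans _ _ (Num.sqrt (f y)))// ?ler_sqrt ?ltW// ltrDl sqrtr_gt0.
Unshelve. all: by end_near. Qed.

End loclip_calculus.

Section loclip_matrix.
Variables (R : realType) (V : normedModType R).

Lemma ler_entry_norm m n (A : 'M[R]_(m, n)) i j : `|A i j| <= `|A|.
Proof.
by rewrite [leRHS]/Num.Def.normr/= mx_normrE; exact: (le_bigmax _ _ (i, j)).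
Qed.

Lemma ler_norm_entries m n (A : 'M[R]_(m, n)) (e : R) : 0 <= e ->
  (forall i j, `|A i j| <= e) -> `|A| <= e.
Proof.
move=> e0 Ae.
by rewrite [leLHS]/Num.Def.normr/= mx_normrE (bigmax_le _ e0).
Qed.

(** The norm of a matrix is the largest absolute value of an entry. *)
Lemma loclip_mxP m n (f : V -> 'M[R]_(m, n)) (x : V) :
  loclip f x <-> (forall i j, loclip (fun y => f y i j) x).
Proof.
split=> [[k k0 [U xU kf]] i j|fx].
  exists k => //; exists U => // y z Uy Uz.
  rewrite (le_trans _ (kf _ _ Uy Uz))// (le_trans _ (ler_entry_norm _ i j))//.
  by rewrite !mxE.
apply: (@loclip_near_eq _ _ _ (fun y => \sum_i \sum_j f y i j *: delta_mx i j)).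
  by apply: nearW => y; rewrite -matrix_sum_delta.
do 2!apply: loclip_sum => ? _.
by apply: loclipZ => //; exact: loclip_cst.
Qed.

Lemma loclip_mulmx m n p (f : V -> 'M[R]_(m, n)) (g : V -> 'M[R]_(n, p))
    (x : V) :
  loclip f x -> loclip g x -> loclip (fun y => f y *m g y) x.
Proof.
move=> /loclip_mxP fx /loclip_mxP gx; apply/loclip_mxP => i j.
apply: (@loclip_near_eq _ _ R (fun y => \sum_k f y i k * g y k j)).
  by apply: nearW => y; rewrite mxE.
by apply: loclip_sum => k _; exact: loclipM.
Qed.

Lemma loclip_det n (f : V -> 'M[R]_n) (x : V) :
  loclip f x -> loclip (fun y => \det (f y)) x.
Proof.
move=> /loclip_mxP fx; apply: loclip_sum => s _.
apply: loclipM; first exact: loclip_cst.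
exact: loclip_prod.
Qed.

End loclip_matrix.

Section C11.
Variable R : realType.

Lemma locally_lipschitz_loclip (V W : normedModType R) (D : set V)
    (f : V -> W) : open D ->
  locally_lipschitz D f <-> (forall x, D x -> loclip f x).
Proof.
move=> oD; split=> [fD x Dx|fD x Dx].
  have [U xU [M [Mr kf]]] := fD x Dx.
  exists (`|M| + 1); first exact: ltr_wpDl.
  exists (U `&` D); first by apply: filterI => //; exact: open_nbhs_nbhs.
  move=> y z Uy Uz; apply: (kf _ _ (y, z)) => //.
  by rewrite (le_lt_trans (ler_norm _))// ltrDl.
have [k k0 [U xU kf]] := fD x Dx.
exists U => //; exists k; split; first exact: gtr0_real.
move=> k' kk' [y z] /= [[Uy Dy] [Uz Dz]].
by rewrite (le_trans (kf _ _ Uy Uz))// ler_wpM2r// ltW.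
Qed.

(** The mean value theorem on a segment holds for one entry at a time: the
intermediate point depends on the entry. *)
Lemma mean_value_entry n m (f : 'rV[R]_n -> 'rV[R]_m) (y v : 'rV[R]_n) j :
  (forall t : R, 0 <= t <= 1 -> differentiable f (y + t *: v)) ->
  exists2 t : R, 0 <= t <= 1 &
    (f (y + v) - f y) 0 j = (v *m 'J f (y + t *: v)) 0 j.
Proof.
move=> df; pose g (t : R) : R := f (y + t *: v) 0 j.
have dg (t : R) : 0 <= t <= 1 ->
    is_derive t 1 g ((v *m 'J f (y + t *: v)) 0 j).
  move=> /df dft; have dv := @diff_derivable _ _ _ _ _ v dft.
  have dj : derivable (fun x => f x 0 j) (y + t *: v) v.
    by move/derivable_mxP : dv.
  have gE h : h^-1 *: (g (h *: 1 + t) - g t) = h^-1 *: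
      (f (h *: v + (y + t *: v)) 0 j - f (y + t *: v) 0 j).
    by rewrite /g [h *: 1]mulr1 scalerDl addrCA.
  split.
    rewrite /derivable; under eq_fun do rewrite gE; exact: dj.
  rewrite -deriveEjacobian// derive_mx// mxE /derive.
  by under eq_fun do rewrite gE.
have cg : {within `[(0:R), 1], continuous g}.
  apply: derivable_within_continuous => s.
  by rewrite in_itv/= => /dg [].
have dg' (t : R) : t \in `](0:R), 1[%R ->
    is_derive t 1 g ((v *m 'J f (y + t *: v)) 0 j).
  by rewrite in_itv/= => /andP[t0 t1]; apply: dg; rewrite !ltW.
have [t] := MVT_segment ler01 dg' cg.
rewrite in_itv/= subr0 mulr1 /g scale1r scale0r addr0 => t01 gE.
by exists t => //; rewrite -gE !mxE.
Qed.

Lemma C11_loclip_jacobian n (D : set 'rV[R]_n) (f : 'rV[R]_n -> 'rV[R]_n) x :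
  open D -> C11_on D f -> D x -> loclip (fun y => 'J f y) x.
Proof. by move=> oD [_ /locally_lipschitz_loclip]; apply. Qed.

(** The Jacobian is locally Lipschitz, hence bounded on a ball; the mean value
theorem on segments of this ball gives the Lipschitz constant. *)
Lemma C11_loclip n (D : set 'rV[R]_n) (f : 'rV[R]_n -> 'rV[R]_n) x :
  open D -> C11_on D f -> D x -> loclip f x.
Proof.
move=> oD fD Dx.
have /loclip_bounded[B B0 BJ] := C11_loclip_jacobian oD fD Dx.
have xD : nbhs x D by exact: open_nbhs_nbhs.
have /nbhs_ballP[e /= e0 xe] : nbhs x (D `&` [set y | `|'J f y| <= B]) by exact: filterI.
exists (n%:R * B + 1); first by rewrite ltr_wpDl// mulr_ge0// ltW.
exists (ball x e); first exact: nbhsx_ballx.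
move=> y z xy xz; rewrite distrC (distrC y).
set v := z - y.
have seg (t : R) : 0 <= t <= 1 -> ball x e (y + t *: v).
  move=> /andP[t0 t1]; move: xy xz; rewrite -ball_normE/= => xy xz.
  have -> : x - (y + t *: v) = (1 - t) *: (x - y) + t *: (x - z).
    by rewrite /v; apply/matrixP => i j; rewrite !mxE; ring.
  rewrite (le_lt_trans (ler_normD _ _))// !normrZ ger0_norm ?subr_ge0//.
  rewrite (ger0_norm t0).
  have [->|t10] := eqVneq t 1; first by rewrite subrr mul0r add0r mul1r.
  have : 0 < 1 - t by rewrite subr_gt0 lt_neqAle t10.
  by move: xy xz; set a := `| _ |; set b := `| _ |; nra.
apply: ler_norm_entries; first by rewrite mulr_ge0// addr_ge0// mulr_ge0// ltW.
move=> i j; rewrite (ord1 i) {i}.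
have [t t01] := @mean_value_entry n n f y v j (fun t h => fD.1 _ (xe _ (seg t h)).1).
have -> : y + v = z by rewrite /v addrC subrK.
move=> ->; rewrite mxE.
have BJt : `|'J f (y + t *: v)| <= B by exact: (xe _ (seg t t01)).2.
rewrite (le_trans (ler_norm_sum _ _ _))//.
rewrite (@le_trans _ _ (\sum_(k < n) `|v| * B))//.
  apply: ler_sum => k _; rewrite normrM ler_pM//; first exact: ler_entry_norm.
  by rewrite (le_trans _ BJt)// ler_entry_norm.
rewrite sumr_const card_ord -mulr_natl.
have := normr_ge0 v; set a := `|v|; lra.
Qed.

End C11.

(** * Lebesgue measure on tuples *)

Section lebesgue_n.
Variable R : realType.
Local Notation RT := (measurableTypeR R).

(** The cubes exhaust the space and have finite measure; they witness
sigma-finiteness. *)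
Definition cube n (C : R) : set (n.-tuple RT) :=
  [set t | forall j, `|tnth t j| <= C].

Lemma measurable_tuple_cons n : measurable_fun setT (@tuple_cons R n).
Proof.
apply: (@measurable_cons _ _ _ _ fst n snd).
  exact: measurable_fst.
exact: measurable_snd.
Qed.

Lemma measurable_cube n C : measurable (@cube n C).
Proof.
have -> : @cube n C = \bigcap_j ((@tnth _ RT ^~ j) @^-1` `[- C, C]).
  apply/seteqP; split=> t /= tC.
    by move=> j _; rewrite /= in_itv/= -ler_norml; exact: tC.
  by move=> j; have := tC j I; rewrite /= in_itv/= -ler_norml.
apply: fin_bigcap_measurable => // j _; rewrite -[X in measurable X]setTI.
by apply: measurable_tnth => //; exact: measurable_itv.
Qed.

Lemma cube_cover n : \bigcup_k @cube n k%:R = setT.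
Proof.
apply/seteqP; split=> // t _.
exists (Num.truncn (\sum_j `|tnth t j|)).+1 => // j.
rewrite (le_trans _ (ltW (truncnS_gt _)))//.
by rewrite (bigD1 j)//= lerDl sumr_ge0.
Qed.

(** The iterated product is defined as a bare set function. Being a measure and
being sigma-finite are proved by one induction, because the product with a
factor is a measure only when this factor is sigma-finite. *)
Lemma lebesgue_n_measure n :
  exists2 m : {sigma_finite_measure set (n.-tuple RT) -> \bar R},
    (m : set (n.-tuple RT) -> \bar R) = @lebesgue_n R n &
    forall C : R, (m (cube C) < +oo)%E.
Proof.
elim: n => [|n [m mE mC]].
  exists (dirac ([tuple] : 0.-tuple RT)) => // C.
  by rewrite /= diracE ltry.
pose mu := measure_function_pushforward__canonical__measure_function_Measure
  (lebesgue_measure \x m)%E (@measurable_tuple_cons n).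
have muC (C : R) : (mu (cube C) < +oo)%E.
  have -> : mu (cube C) = (lebesgue_measure \x m)%E (`[- C, C]%classic `*` cube C).
    rewrite /mu /= /pushforward; congr (product_measure1 _ _ _).
    apply/seteqP; split=> -[x t] /=.
      move=> xt; split; first by have := xt ord0; rewrite /= in_itv/= -ler_norml.
      by move=> j; have := xt (lift ord0 j); rewrite tnthS.
    rewrite in_itv/= -ler_norml => -[xC tC] j.
    by have [i ->|->//] := unliftP ord0 j; rewrite tnthS.
  rewrite product_measure1E//; last exact: measurable_cube.
  rewrite lte_mul_pinfty// ?mC//.
  by rewrite /= lebesgue_measure_itv/=; case: ifP.
have muS : sigma_finite setT mu.
  exists (fun k => cube k%:R); first by rewrite cube_cover.
  by move=> k; split; [exact: measurable_cube|exact: muC].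
pose b := Measure_isSigmaFinite.Build _ _ _ mu muS.
pose nu : {sigma_finite_measure set (n.+1.-tuple RT) -> \bar R} :=
  HB.pack (mu : set _ -> \bar R) (Measure.on mu) b.
exists nu.
  by rewrite /= /mu/= mE.
exact: muC.
Qed.

(** The sigma-algebra on tuples is generated by the projections, so boxes are
measurable, and an open set is the union of the rational boxes inside it. *)
Lemma measurable_row_of_open n (O : set 'rV[R]_n) :
  open O -> measurable (@row_of R n @^-1` O).
Proof.
move=> oO.
pose box (i : {ffun 'I_n -> rat} * nat) : set (n.-tuple RT) :=
  \bigcap_j ((@tnth _ RT ^~ j) @^-1`
     `](ratr (i.1 j) - i.2.+1%:R^-1), (ratr (i.1 j) + i.2.+1%:R^-1)[).
have boxE i t : box i t <->
    (forall j, `|ratr (i.1 j) - tnth t j| < i.2.+1%:R^-1).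
  split=> [it j|it j _]; last first.
    by rewrite /= in_itv/= -ltr_distl distrC; exact: it.
  by have := it j I; rewrite /= in_itv/= -ltr_distl distrC.
have mbox i : measurable (box i).
  apply: fin_bigcap_measurable => // j _; rewrite -[X in measurable X]setTI.
  by apply: measurable_tnth => //; exact: measurable_itv.
have -> : @row_of R n @^-1` O = \bigcup_i
    (if pselect (box i `<=` @row_of R n @^-1` O) then box i else set0).
  apply/seteqP; split=> [t Ot|t [i _]]; last first.
    by case: pselect => // h; exact: h.
  have /nbhs_ballP[e /= e0 eO] : nbhs (row_of t) O by exact: open_nbhs_nbhs.
  have [k _ ke] := near_infty_natSinv_lt (PosNum (divr_gt0 e0 (ltr0n R 2))).
  have {}ke : k.+1%:R^-1 < e / 2 by exact: (ke k (leqnn k)).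
  have k0 : (0 : R) < k.+1%:R^-1 by rewrite invr_gt0.
  have qP j : {q : rat | `|ratr q - tnth t j| < k.+1%:R^-1}.
    apply: cid.
    have /rat_in_itvoo[q qt] : tnth t j - k.+1%:R^-1 < tnth t j + k.+1%:R^-1.
      by rewrite ltrD2l gtrN.
    by exists q; move: qt; rewrite in_itv/= ltr_distl.
  exists ([ffun j => sval (qP j)], k) => //.
  case: pselect => [h|[]]; first by
    rewrite /=; apply/boxE => j; rewrite ffunE; exact: (svalP (qP j)).
  move=> t' /boxE t'k; apply: eO; rewrite -ball_normE/=.
  apply: (@le_lt_trans _ _ (k.+1%:R^-1 + k.+1%:R^-1)); last first.
    by rewrite [ltRHS]splitr ltrD.
  rewrite [leLHS]/Num.Def.normr/= mx_normrE bigmax_le ?addr_ge0 ?(ltW k0)//.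
  move=> [i j] _ /=; rewrite !mxE.
  have -> : tnth t j - tnth t' j = (ratr (sval (qP j)) - tnth t' j)
      - (ratr (sval (qP j)) - tnth t j) by ring.
  rewrite (le_trans (ler_normB _ _))// lerD//.
    by have := t'k j; rewrite ffunE => /ltW.
  by apply: ltW; exact: (svalP (qP j)).
apply: countable_bigcupT_measurable => [|i]; first exact: countableP.
by case: pselect => h; [exact: mbox|exact: measurable0].
Qed.

Lemma measurable_row_of_closed n (A : set 'rV[R]_n) :
  closed A -> measurable (@row_of R n @^-1` A).
Proof.
move=> /closed_openC/measurable_row_of_open/measurableC.
by rewrite -preimage_setC setCK.
Qed.

Lemma open_continuous_measurable_row n (O : set 'rV[R]_n)
    (f : 'rV[R]_n -> R) : open O -> (forall y, O y -> {for y, continuous f}) ->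
  measurable_fun (@row_of R n @^-1` O) (f \o @row_of R n).
Proof.
move=> oO cf; apply: (measurability _ (measurable_realfun.RGenOpens.measurableE R)).
move=> _ [_ [a [b ->] <-]].
apply: (@measurable_row_of_open _ (O `&` f @^-1` `]a, b[%classic)).
rewrite openE => y [Oy fy]; apply: filterI; first exact: open_nbhs_nbhs.
by apply: cf => //; apply: open_nbhs_nbhs; split=> //; exact: interval_open.
Qed.

End lebesgue_n.

(** * Charts and extension by zero of sections given in a chart *)

Section jacobian.
Variable R : realType.

Lemma eq_mulmx_rV m p (A B : 'M[R]_(m, p)) :
  (forall u : 'rV_m, u *m A = u *m B) -> A = B.
Proof. by move=> AB; apply/row_matrixP => i; rewrite !rowE. Qed.

Lemma jacobian_comp m p q (f : 'rV[R]_m -> 'rV[R]_p) (g : 'rV[R]_p -> 'rV[R]_q)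
    (y : 'rV[R]_m) :
  differentiable f y -> differentiable g (f y) ->
  'J (g \o f) y = 'J f y *m 'J g (f y).
Proof.
move=> fy gy; apply/eq_mulmx_rV => u.
by rewrite mulmxA /jacobian !mul_rV_lin1 diff_comp.
Qed.

Lemma near_eq_jacobian m p (f g : 'rV[R]_m -> 'rV[R]_p) (y : 'rV[R]_m) :
  differentiable f y -> differentiable g y -> (\near y, f y = g y) ->
  'J f y = 'J g y.
Proof.
move=> fy gy fg; apply/eq_mulmx_rV => u.
apply: etrans (esym (deriveEjacobian u fy)) _.
by apply: etrans (deriveEjacobian u gy); exact: near_eq_derive.
Qed.

Lemma jacobian_id m (y : 'rV[R]_m) : 'J id y = 1%:M.
Proof.
apply/eq_mulmx_rV => u; rewrite mulmx1 -deriveEjacobian//.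
by rewrite derive_val.
Qed.

Lemma mulmx1_det_neq0 m (A B : 'M[R]_m) : A *m B = 1%:M -> \det A != 0.
Proof.
move=> /(congr1 determinant); rewrite det_mulmx det1 => AB.
by apply/eqP => a0; move/eqP: AB; rewrite a0 mul0r eq_sym oner_eq0.
Qed.
End jacobian.

Local Notation dom_ c := (chart_dom (atlas c)).
Local Notation coord_ c := (chart_coord (atlas c)).
Local Notation param_ c := (chart_param (atlas c)).
Local Notation im_ c := (coord_ c @` dom_ c).

Section charts.
Variables (R : realType) (n : nat) (M : C11_manifold R n).
Implicit Types (c d e : chart_index M) (x : M).

Lemma coord_continuous_at c x : dom_ c x -> {for x, continuous (coord_ c)}.
Proof.
move=> cx; have := @Defs.coord_continuous _ _ _ (atlas c).
by rewrite continuous_open_subspace; [apply; rewrite inE|exact: dom_open].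
Qed.

Lemma param_continuous_at c y : im_ c y -> {for y, continuous (param_ c)}.
Proof.
move=> cy; have := @Defs.param_continuous _ _ _ (atlas c).
by rewrite continuous_open_subspace; [apply; rewrite inE|exact: coord_open].
Qed.

Lemma param_dom c y : im_ c y -> dom_ c (param_ c y).
Proof. by move=> [x cx <-]; rewrite coordK. Qed.

Lemma paramK c y : im_ c y -> coord_ c (param_ c y) = y.
Proof. by move=> [x cx <-]; rewrite coordK. Qed.

Lemma coord_im c x : dom_ c x -> im_ c (coord_ c x).
Proof. by move=> cx; exists x. Qed.

Lemma coord_image_setI c (A : set M) :
  coord_ c @` (dom_ c `&` A) = im_ c `&` param_ c @^-1` A.
Proof.
apply/seteqP; split=> [_ [x [cx Ax] <-]|y [cy Ay]].
  by split; [exact: coord_im|rewrite /= coordK].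
by exists (param_ c y); rewrite ?paramK//; split=> //; exact: param_dom.
Qed.

Lemma open_coord_image c (U : set M) :
  open U -> open (coord_ c @` (dom_ c `&` U)).
Proof.
move=> oU; rewrite coord_image_setI openE => y [cy Uy]; apply: filterI.
  by apply: open_nbhs_nbhs; split=> //; exact: coord_open.
by apply: (param_continuous_at cy); exact: open_nbhs_nbhs.
Qed.

Lemma nbhs_coord_image c x : dom_ c x -> nbhs (coord_ c x) (im_ c).
Proof.
move=> cx; apply: open_nbhs_nbhs; split; first exact: coord_open.
exact: coord_im.
Qed.

Lemma nbhs_coord c x (U : set M) : dom_ c x -> nbhs x U ->
  \forall y \near coord_ c x, im_ c y /\ U (param_ c y).
Proof.
move=> cx xU; apply: filterI; first exact: nbhs_coord_image.
by apply: (param_continuous_at (coord_im cx)); rewrite coordK.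
Qed.

Lemma nbhs_dom c x : dom_ c x -> nbhs x (dom_ c).
Proof. by move=> cx; apply: open_nbhs_nbhs; split=> //; exact: dom_open. Qed.

Lemma transition_differentiable c d x : dom_ c x -> dom_ d x ->
  differentiable (transition (atlas c) (atlas d)) (coord_ c x).
Proof.
by move=> cx dx; apply: (atlas_compatible c d).1.1; exists x.
Qed.

Lemma transition_loclip c d x : dom_ c x -> dom_ d x ->
  loclip (transition (atlas c) (atlas d)) (coord_ c x).
Proof.
move=> cx dx; apply: C11_loclip (atlas_compatible c d).1 _.
  by apply: open_coord_image; exact: dom_open.
by exists x.
Qed.

Lemma jacobian_transition_loclip c d x : dom_ c x -> dom_ d x ->
  loclip (fun y => 'J (transition (atlas c) (atlas d)) y) (coord_ c x).
Proof.
move=> cx dx; apply: C11_loclip_jacobian (atlas_compatible c d).1 _.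
  by apply: open_coord_image; exact: dom_open.
by exists x.
Qed.

(** The chain rule for the transition maps; it is the cocycle condition that lets
[chart_section] define a section. *)
Lemma jac_comp c d e x : dom_ c x -> dom_ d x -> dom_ e x ->
  jac c d x *m jac d e x = jac c e x.
Proof.
move=> cx dx ex.
have dcd := transition_differentiable cx dx.
have cdx : transition (atlas c) (atlas d) (coord_ c x) = coord_ d x.
  by rewrite /transition /= coordK.
have dde : differentiable (transition (atlas d) (atlas e))
    (transition (atlas c) (atlas d) (coord_ c x)).
  by rewrite cdx; exact: transition_differentiable.
transitivity ('J (transition (atlas d) (atlas e) \o transition (atlas c) (atlas d))
                 (coord_ c x)).
  by rewrite (jacobian_comp dcd dde) cdx.
apply: near_eq_jacobian.
- exact: differentiable_comp.
- exact: transition_differentiable.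
have := nbhs_coord cx (nbhs_dom dx); apply: filterS => y [cy dy].
by rewrite /transition /= coordK.
Qed.

Lemma jac_id c x : dom_ c x -> jac c c x = 1%:M.
Proof.
move=> cx; rewrite -(jacobian_id (coord_ c x)); apply: near_eq_jacobian => //.
  exact: transition_differentiable.
have := nbhs_coord_image cx; apply: filterS => y cy.
by rewrite /transition /= paramK.
Qed.

Lemma det_jac_neq0 c d x : dom_ c x -> dom_ d x -> \det (jac c d x) != 0.
Proof.
move=> cx dx; apply: (@mulmx1_det_neq0 _ _ _ (jac d c x)).
by rewrite (jac_comp cx dx cx) jac_id.
Qed.

Lemma jac_param c d y : im_ d y ->
  jac c d (param_ d y) = 'J (transition (atlas c) (atlas d))
                           (transition (atlas d) (atlas c) y).
Proof. by []. Qed.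

#[local] Opaque jac.

Lemma density_actM p (J K : 'M[R]_n) :
  density_act p (J *m K) = density_act p J * density_act p K.
Proof. by rewrite /density_act det_mulmx normrM powRM. Qed.

Lemma density_act1 p : density_act p (1%:M : 'M[R]_n) = 1.
Proof. by rewrite /density_act det1 normr1 powR1. Qed.

Lemma density_act_half (J : 'M[R]_n) :
  density_act 2^-1 J = (Num.sqrt `|\det J|)^-1.
Proof. by rewrite /density_act powRN powR12_sqrt. Qed.

Lemma density_act_sqr_half (J : 'M[R]_n) : \det J != 0 ->
  density_act 2^-1 J * density_act 2^-1 J = density_act 1 J.
Proof.
move=> J0; rewrite /density_act -powRD; last first.
  by apply/implyP => _; rewrite normr_eq0.
by congr powR; field.
Qed.

Lemma loclip_density_half (V : normedModType R) (J : V -> 'M[R]_n) (x : V) :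
  loclip J x -> \det (J x) != 0 -> loclip (fun y => density_act 2^-1 (J y)) x.
Proof.
move=> Jx J0.
apply: (@loclip_near_eq _ _ R (fun y => (Num.sqrt `|\det (J y)|)^-1)).
  by apply: nearW => y; rewrite density_act_half.
apply: loclip_inv; last by rewrite sqrtr_eq0 -ltNge normr_gt0.
apply: loclip_sqrt; last by rewrite normr_gt0.
by apply: loclip_norm; exact: loclip_det.
Qed.

(** What is needed of a fibre action for the extension by zero of a section given
in one chart to be a locally Lipschitz section: vector fields and half-densities
are both of this kind. *)
Definition loclip_act (F : normedModType R) (act : 'M[R]_n -> F -> F) :=
  [/\ forall J, act J 0 = 0,
      forall J K u, act (J *m K) u = act K (act J u),
      forall u, act 1%:M u = u &
      forall (V : normedModType R) (J : V -> 'M[R]_n) (u : V -> F) (x : V),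
        loclip J x -> loclip u x -> \det (J x) != 0 ->
        loclip (fun y => act (J y) (u y)) x].

Lemma loclip_tangent_act : loclip_act (@tangent_act R n).
Proof.
split; first by move=> J; rewrite /tangent_act mul0mx.
- by move=> J K u; rewrite /tangent_act mulmxA.
- by move=> u; rewrite /tangent_act mulmx1.
- by move=> V J u x Jx ux _; exact: loclip_mulmx.
Qed.

(** The weight |det J|^(-1/2) is locally Lipschitz because det J does not vanish,
so that the square root is taken away from 0. *)
Lemma loclip_half_density_vector_act : loclip_act (@half_density_vector_act R n).
Proof.
split; first by move=> J; rewrite /half_density_vector_act /tangent_act mul0mx scaler0.
- move=> J K u; rewrite /half_density_vector_act /tangent_act.
  by rewrite density_actM -scalemxAl scalerA mulmxA [in LHS]mulrC.
- move=> u; rewrite /half_density_vector_act /tangent_act.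
  by rewrite density_act1 mulmx1 scale1r.
- move=> V J u x Jx ux J0; apply: loclipZ; first exact: loclip_density_half.
  exact: loclip_mulmx.
Qed.

(** The section with components [f] in the chart [c], extended by zero outside the
domain of [c]. *)
Definition chart_section (F : nmodType) (act : 'M[R]_n -> F -> F) c
    (f : 'rV[R]_n -> F) : components M F :=
  fun d x => if `[< dom_ c x /\ dom_ d x >] then act (jac c d x) (f (coord_ c x))
             else 0.

Section chart_section.
Variables (F : normedModType R) (act : 'M[R]_n -> F -> F).
Hypothesis actP : loclip_act act.
Variables (c : chart_index M) (K : set 'rV[R]_n) (f : 'rV[R]_n -> F).
Hypotheses (cK : compact K) (Kc : K `<=` im_ c).
Hypotheses (fK : forall y, ~ K y -> f y = 0).
Local Notation s := (chart_section act c f).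

Lemma chart_section_self x : dom_ c x -> s c x = f (coord_ c x).
Proof.
move=> cx; rewrite /chart_section asboolT//.
by rewrite jac_id//; have [_ _ ->] := actP.
Qed.

Lemma compact_param_image : compact (param_ c @` K).
Proof.
apply: continuous_compact => //; apply: continuous_in_subspaceT => y.
by rewrite inE => /Kc; exact: param_continuous_at.
Qed.

Lemma closed_param_image : closed (param_ c @` K).
Proof. exact: compact_closed (@carrier_hausdorff _ _ M) compact_param_image. Qed.

Lemma chart_section_out d x : ~ (param_ c @` K) x -> s d x = 0.
Proof.
move=> xK; rewrite /chart_section; case: asboolP => // -[cx dx].
rewrite fK; first by have [-> _ _ _] := actP.
by move=> Kx; apply: xK; exists (coord_ c x) => //; rewrite coordK.
Qed.

Lemma chart_section_is_section : is_section act s.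
Proof.
have [act0 actM _ _] := actP; split=> [d x dx|d e x dx ex].
  by rewrite /chart_section asboolF// => -[].
rewrite /chart_section; have [cx|cx] := pselect (dom_ c x).
  rewrite (asboolT (conj cx ex)) (asboolT (conj cx dx)).
  by apply: etrans (actM _ _ _); congr act; exact: esym (jac_comp cx dx ex).
by rewrite !asboolF ?act0// => -[].
Qed.

Lemma chart_section_compact_support : compact_support s.
Proof.
apply: (subclosed_compact _ compact_param_image); first exact: closed_closure.
rewrite closureE; apply: bigcap_inf; split; first exact: closed_param_image.
move=> x [d dx sx]; apply: contrapT => xK; apply: sx.
exact: chart_section_out.
Qed.

(** In another chart, near a point of the domain of [c], the components are
obtained from [f] by composition with the transition map and by the action of
its Jacobian. The image of [K] is compact, hence closed since the manifold is
Hausdorff, so near any other point the section vanishes. *)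
Lemma chart_section_lipschitz : (forall y, loclip f y) -> lipschitz_components s.
Proof.
move=> lf d; apply/locally_lipschitz_loclip; first exact: coord_open.
move=> _ [x dx <-]; have [xK|xK] := pselect ((param_ c @` K) x); last first.
  apply: (@loclip_near_eq _ _ _ (fun=> 0)); last exact: loclip_cst.
  have xK' : nbhs x (~` (param_ c @` K)).
    by apply: open_nbhs_nbhs; split=> //; apply: closed_openC; exact: closed_param_image.
  have := nbhs_coord dx xK'; apply: filterS => y [dy yK] /=.
  by rewrite chart_section_out.
have cx : dom_ c x by case: xK => y Ky <-; apply: param_dom; exact: Kc.
have [_ _ _ actL] := actP.
have dcx : transition (atlas d) (atlas c) (coord_ d x) = coord_ c x.
  by rewrite /transition /= coordK.
apply: (@loclip_near_eq _ _ _ (fun y =>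
    act ('J (transition (atlas c) (atlas d)) (transition (atlas d) (atlas c) y))
        (f (transition (atlas d) (atlas c) y)))).
  have := nbhs_coord dx (nbhs_dom cx); apply: filterS => y [dy cy] /=.
  by rewrite /chart_section asboolT ?jac_param//; split=> //; exact: param_dom.
have tl := transition_loclip dx cx.
apply: actL.
- apply: (@loclip_comp _ _ _ _ _ (fun y => 'J (transition (atlas c) (atlas d)) y)) => //.
  by rewrite dcx; exact: jacobian_transition_loclip.
- by apply: (@loclip_comp _ _ _ _ _ f).
- by rewrite dcx; exact: det_jac_neq0.
Qed.

End chart_section.

End charts.

(** * Cutoffs, half-densities and test sections *)

Section bump.
Variables (R : realType) (n : nat).

Definition cball (y0 : 'rV[R]_n) (r : R) := [set y | `|y - y0| <= r].

Lemma compact_cball y0 r : compact (cball y0 r).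
Proof.
apply: bounded_closed_compact.
  exists (`|y0| + r); split; first exact: num_real.
  move=> B rB y /= yr; rewrite (le_trans _ (ltW rB))//.
  by rewrite -[y](subrK y0) addrC (le_trans (ler_normD _ _))// lerD2l.
have -> : cball y0 r = (fun y => `|y - y0|) @^-1` [set x : R | x <= r] by [].
apply: closed_comp; last exact: closed_le.
move=> y _; apply: (@loclip_continuous _ _ R (fun y => `|y - y0|)).
by apply: loclip_norm; apply: loclipB; [exact: loclip_id|exact: loclip_cst].
Qed.

Lemma cballW y0 r r' : r <= r' -> cball y0 r `<=` cball y0 r'.
Proof. by move=> rr' y /= /le_trans; apply. Qed.

Lemma cball_double y0 r : 0 < r -> cball y0 r `<=` cball y0 (2 * r).
Proof.
by move=> r0; apply: cballW; rewrite ler_peMl ?(ltW r0)// (ler_nat R 1 2).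
Qed.

Lemma ball_cball y0 r : ball y0 r `<=` cball y0 r.
Proof. by move=> y; rewrite -ball_normE/= distrC => /ltW. Qed.

Lemma loclip_max (V : normedModType R) (f g : V -> R) (x : V) :
  loclip f x -> loclip g x -> loclip (fun y => Num.max (f y) (g y)) x.
Proof.
move=> fx gx.
apply: (@loclip_near_eq _ _ R (fun y => (f y + g y + `|f y - g y|) / 2)).
  by apply: nearW => y; rewrite maxr_absE.
apply: loclipM; last exact: loclip_cst.
by apply: loclipD; [exact: loclipD|apply: loclip_norm; exact: loclipB].
Qed.

Lemma loclip_min (V : normedModType R) (f g : V -> R) (x : V) :
  loclip f x -> loclip g x -> loclip (fun y => Num.min (f y) (g y)) x.
Proof.
move=> fx gx.
apply: (@loclip_near_eq _ _ R (fun y => (f y + g y - `|f y - g y|) / 2)).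
  by apply: nearW => y; rewrite minr_absE.
apply: loclipM; last exact: loclip_cst.
by apply: loclipB; [exact: loclipD|apply: loclip_norm; exact: loclipB].
Qed.

Definition bump (y0 : 'rV[R]_n) (r : R) (y : 'rV[R]_n) : R :=
  Num.max 0 (Num.min 1 (2 - `|y - y0| / r)).

Lemma bump1 y0 r y : 0 < r -> cball y0 r y -> bump y0 r y = 1.
Proof.
move=> r0 yr; have : `|y - y0| / r <= 1 by rewrite ler_pdivrMr// mul1r.
rewrite /bump => y1; rewrite min_l; first by rewrite max_r.
lra.
Qed.

Lemma bump0 y0 r y : 0 < r -> ~ cball y0 (2 * r) y -> bump y0 r y = 0.
Proof.
move=> r0 /negP; rewrite -ltNge -ltr_pdivlMr// => yr.
by rewrite /bump max_l// ge_min subr_le0 (ltW yr) orbT.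
Qed.

Lemma loclip_bump y0 r y : loclip (bump y0 r) y.
Proof.
apply: loclip_max; first exact: loclip_cst.
apply: loclip_min; first exact: loclip_cst.
apply: loclipB; first exact: loclip_cst.
apply: loclipM; last exact: loclip_cst.
by apply: loclip_norm; apply: loclipB; [exact: loclip_id|exact: loclip_cst].
Qed.

End bump.

(** Stated for arbitrary neighbourhoods and without a base point, since the
manifold may be empty. *)
Lemma compact_finite_cover (T : topologicalType) (A : set T) (U : T -> set T) :
  compact A -> (forall x, A x -> nbhs x (U x)) ->
  exists2 s : seq T, (forall x, x \in s -> A x) &
    forall x, A x -> exists2 z, z \in s & U z x.
Proof.
move=> /compact_near_coveringP cA AU.
(* Finite lists, ordered by inclusion, index the near-covering property. *)
pose F := filter_from [set: seq T] (fun s => [set t : seq T | {subset s <= t}]).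
have FF : Filter F.
  apply: filter_from_filter; first by exists [::].
  move=> s t _ _; exists (s ++ t) => // u stu.
  by split=> z zs; apply: stu; rewrite mem_cat zs ?orbT.
have [x Ax|s _ /(_ s (fun _ h => h)) As] :=
    cA _ F (fun t x => exists2 z, z \in [seq z <- t | `[< A z >]] & U z x) FF.
  exists (U x, [set t : seq T | {subset [:: x] <= t}]) => /=.
    by split; [exact: AU|exists [:: x]].
  move=> [x' t] /= [Ux' xt]; exists x => //.
  by rewrite mem_filter xt ?mem_head// andbT; exact/asboolP.
exists [seq z <- s | `[< A z >]] => //.
by move=> x; rewrite mem_filter => /andP[/asboolP].
Qed.

Lemma continuous_compact_bounded (R : realType) (T : topologicalType)
    (K : set T) (f : T -> R) : compact K ->
  (forall x, K x -> {for x, continuous f}) ->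
  exists2 B, 0 < B & forall x, K x -> `|f x| <= B.
Proof.
move=> cK cf; have : compact (f @` K).
  apply: continuous_compact => //; apply: continuous_in_subspaceT => x.
  by rewrite inE; exact: cf.
move=> /compact_bounded[B [_ fB]]; exists (`|B| + 1); first exact: ltr_wpDl.
move=> x Kx; apply: fB; last by exists x.
by rewrite (le_lt_trans (ler_norm _))// ltrDl.
Qed.

Section sections.
Variables (R : realType) (n : nat) (M : C11_manifold R n).
Implicit Types (c d e : chart_index M) (x : M).
#[local] Opaque jac.

Lemma cball_in_chart c x : dom_ c x ->
  exists2 r : R, 0 < r & cball (coord_ c x) r `<=` im_ c.
Proof.
move=> cx; have /nbhs_ballP[e /= e0 ec] := nbhs_coord_image cx.
exists (e / 2); first by rewrite divr_gt0.
move=> y /= ye; apply: ec; rewrite -ball_normE/= distrC (le_lt_trans ye)//.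
by rewrite ltr_pdivrMr// ltr_pMr// (ltr_nat R 1 2).
Qed.

Lemma open_chart_ball c y0 (r : R) :
  open (dom_ c `&` coord_ c @^-1` ball y0 r).
Proof.
rewrite openE => x [cx xr]; apply: filterI; first exact: nbhs_dom.
apply: (coord_continuous_at cx); apply: open_nbhs_nbhs; split=> //.
exact: ball_open.
Qed.

(** The double of each ball is still in the chart: it supports a cutoff equal to 1
on the ball. *)
Lemma finite_ball_cover c (K : set M) : compact K -> K `<=` dom_ c ->
  exists (s : seq M) (r : M -> R),
    (forall z, z \in s -> 0 < r z /\ cball (coord_ c z) (2 * r z) `<=` im_ c) /\
    (forall x, K x -> exists2 z, z \in s &
       ball (coord_ c z) (r z) (coord_ c x)).
Proof.
move=> cK Kc.
have rP (z : M) : exists r : R, dom_ c z ->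
    0 < r /\ cball (coord_ c z) (2 * r) `<=` im_ c.
  have [cz|cz] := pselect (dom_ c z); last by exists 0.
  have [r r0 rc] := cball_in_chart cz; exists (r / 2) => _.
  by split; [rewrite divr_gt0|rewrite mulrC divfK// pnatr_eq0].
have [r rz] := choice rP.
pose U z := dom_ c `&` coord_ c @^-1` ball (coord_ c z) (r z).
have [z /Kc cz|s sK KU] := @compact_finite_cover _ K U cK.
  apply: open_nbhs_nbhs; split; first exact: open_chart_ball.
  by split=> //; apply: ballxx; exact: (rz z cz).1.
exists s, r; split=> [z zs|x /KU[z zs [_ zx]]]; last by exists z.
by apply: rz; apply: Kc; exact: sK.
Qed.

Lemma lipschitz_half_density_chart_section c (K : set 'rV[R]_n)
    (f : 'rV[R]_n -> 'rV[R]_n) :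
  compact K -> K `<=` im_ c -> (forall y, ~ K y -> f y = 0) ->
  (forall y, loclip f y) ->
  lipschitz_half_density (chart_section (@half_density_vector_act R n) c f).
Proof.
move=> cK Kc fK lf; have actP := @loclip_half_density_vector_act R n.
split; first exact: chart_section_is_section actP _ _.
  exact: chart_section_lipschitz cK Kc fK lf.
exact: chart_section_compact_support cK Kc fK.
Qed.

Lemma lipschitz_vector_field_chart_section c (K : set 'rV[R]_n)
    (f : 'rV[R]_n -> 'rV[R]_n) :
  compact K -> K `<=` im_ c -> (forall y, ~ K y -> f y = 0) ->
  (forall y, loclip f y) ->
  let v := chart_section (@tangent_act R n) c f in
  lipschitz_vector_field v /\ compact_support v.
Proof.
move=> cK Kc fK lf; have actP := @loclip_tangent_act R n.
split; last exact: chart_section_compact_support cK Kc fK.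
split; first exact: chart_section_is_section actP _ _.
exact: chart_section_lipschitz cK Kc fK lf.
Qed.

Lemma compact_support_sub (F G : nmodType) (s : components M F)
    (t : components M G) :
  (forall c x, s c x = 0 -> t c x = 0) -> compact_support s -> compact_support t.
Proof.
move=> st cs; apply: (subclosed_compact _ cs); first exact: closed_closure.
apply: closure_subset => x [c cx tx]; exists c => // sx; apply: tx; exact: st.
Qed.

Lemma compact_support_lincomb (F : lmodType R) a (s t : components M F) :
  compact_support s -> compact_support t -> compact_support (lincomb a s t).
Proof.
move=> cs ct; apply: (subclosed_compact _ (compactU cs ct)).
  exact: closed_closure.
rewrite -closureU; apply: closure_subset => x [c cx stx].
have [sx|sx] := pselect (s c x = 0); last by left; exists c.
right; exists c => // tx; apply: stx.
by rewrite /lincomb sx tx scaler0 addr0.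
Qed.

Lemma lipschitz_half_density_lincomb a (V W : components M 'rV[R]_n) :
  lipschitz_half_density V -> lipschitz_half_density W ->
  lipschitz_half_density (lincomb a V W).
Proof.
move=> [[V0 Vs] Vl Vc] [[W0 Ws] Wl Wc]; split.
- split=> [c x cx|c d x cx dx]; first by rewrite /lincomb V0// W0// scaler0 addr0.
  rewrite /lincomb (Vs _ _ _ cx dx) (Ws _ _ _ cx dx).
  rewrite /half_density_vector_act /tangent_act mulmxDl -scalemxAl scalerDr.
  by rewrite !scalerA [a * _]mulrC.
- move=> c; apply/locally_lipschitz_loclip; first exact: coord_open.
  have /locally_lipschitz_loclip Vc' := Vl c.
  have /locally_lipschitz_loclip Wc' := Wl c.
  move=> y cy; apply: loclipD; last by apply: Wc' => //; exact: coord_open.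
  by apply: loclipZ; [exact: loclip_cst|apply: Vc' => //; exact: coord_open].
- exact: compact_support_lincomb.
Qed.

Lemma half_density_loclip (V : components M 'rV[R]_n) c y :
  lipschitz_half_density V -> im_ c y -> loclip (V c \o param_ c) y.
Proof.
move=> [_ /(_ c) Vl _] cy.
by have /locally_lipschitz_loclip := Vl; apply=> //; exact: coord_open.
Qed.

Lemma half_density_continuous (V : components M 'rV[R]_n) c x :
  lipschitz_half_density V -> dom_ c x -> {for x, continuous (V c)}.
Proof.
move=> hV cx.
have lV := half_density_loclip hV (coord_im cx).
have : {for x, continuous ((V c \o param_ c) \o coord_ c)}.
  apply: continuous_comp; first exact: coord_continuous_at.
  exact: loclip_continuous.
have cE : \near x, ((V c \o param_ c) \o coord_ c) x = V c x.
  by have := nbhs_dom cx; apply: filterS => z cz /=; rewrite coordK.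
rewrite /prop_for /continuous_at /= coordK// => VV.
apply: cvg_trans VV; apply: near_eq_cvg.
by apply: filterS cE => z.
Qed.

Lemma continuous_mx (T : topologicalType) m p (f : T -> 'M[R]_(m, p)) (x : T) :
  (forall i j, {for x, continuous (fun z => f z i j)}) -> {for x, continuous f}.
Proof.
move=> fx; apply/cvgrPdist_le => e e0; near=> z.
apply: ler_norm_entries; first exact: ltW.
move=> i j; rewrite !mxE; move: i j; near: z.
apply: filter_forall => i; apply: filter_forall => j.
by have /cvgrPdist_le := fx i j; apply.
Unshelve. all: by end_near. Qed.

Lemma continuous_entry (T : topologicalType) m p (f : T -> 'M[R]_(m, p)) (x : T) i j :
  {for x, continuous f} -> {for x, continuous (fun z => f z i j)}.
Proof.
move=> fx; apply/cvgrPdist_le => e e0.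
have /cvgrPdist_le := fx; move=> /(_ _ e0); apply: filterS => z.
by apply: le_trans; rewrite (le_trans _ (ler_entry_norm _ i j))// !mxE.
Qed.

Lemma sym_prodE (V W : components M 'rV[R]_n) c x :
  sym_prod V W c x = 2^-1 *: ((V c x)^T *m W c x + (W c x)^T *m V c x).
Proof.
apply/matrixP => i j; rewrite !mxE !big_ord1 !mxE.
by congr (_ * (_ + _)); exact: mulrC.
Qed.

Lemma test_section_sym_prod (V W : components M 'rV[R]_n) :
  lipschitz_half_density V -> lipschitz_half_density W ->
  test_section (sym_prod V W).
Proof.
move=> hV hW; split.
- have [[V0 Vs] _ _] := hV; have [[W0 Ws] _ _] := hW.
  split=> [c x cx|c d x cx dx].
    by apply/matrixP => i j; rewrite !mxE V0// W0// !mxE !mul0r addr0 mulr0.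
  rewrite !sym_prodE (Vs _ _ _ cx dx) (Ws _ _ _ cx dx).
  rewrite /half_density_vector_act /tangent_act /sym2_density_act.
  rewrite -density_act_sqr_half; last exact: det_jac_neq0.
  move: (jac c d x) (density_act _ _) (V c x) (W c x) => J k v w.
  have E (v' w' : 'rV[R]_n) : (k *: (v' *m J))^T *m (k *: (w' *m J)) =
      (k * k) *: (J^T *m (v'^T *m w') *m J).
    by rewrite [(k *: _)^T]linearZ /= trmx_mul -scalemxAl -scalemxAr scalerA !mulmxA.
  rewrite !E -scalemxAr -scalemxAl mulmxDr mulmxDl -scalerDr !scalerA.
  by congr (_ *: _); rewrite mulrC.
- by move=> c x; apply/matrixP => i j; rewrite !mxE addrC.
- move=> c; apply: continuous_in_subspaceT => x; rewrite inE => cx.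
  have Vx := half_density_continuous hV cx.
  have Wx := half_density_continuous hW cx.
  apply: continuous_mx => i j.
  have -> : (fun z => sym_prod V W c z i j) = (fun z => 2^-1 *
      (V c z 0 i * W c z 0 j + V c z 0 j * W c z 0 i)).
    by apply/funext => z; rewrite mxE.
  apply: cvgM; first exact: cvg_cst.
  by apply: cvgD; apply: cvgM; exact: continuous_entry.
- have [_ _] := hV; apply: compact_support_sub => c x V0.
  by apply/matrixP => i j; rewrite !mxE V0 !mxE !mul0r addr0 mulr0.
Qed.

Lemma sym2_density_actD (J A B : 'M[R]_n) a :
  sym2_density_act J (a *: A + B) =
  a *: sym2_density_act J A + sym2_density_act J B.
Proof.
rewrite /sym2_density_act mulmxDr mulmxDl -scalemxAr -scalemxAl scalerDr.
by rewrite !scalerA [_ * a]mulrC.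
Qed.

Lemma test_section_continuous (s : components M 'M[R]_n) c x :
  test_section s -> dom_ c x -> {for x, continuous (s c)}.
Proof.
move=> [_ _ /(_ c) sc _] cx; move: sc.
by rewrite continuous_open_subspace; [apply; rewrite inE|exact: dom_open].
Qed.

Lemma test_section_lincomb a (s t : components M 'M[R]_n) :
  test_section s -> test_section t -> test_section (lincomb a s t).
Proof.
move=> hs ht; split.
- have [[s0 ss] _ _ _] := hs; have [[t0 ts] _ _ _] := ht.
  split=> [c x cx|c d x cx dx]; first by rewrite /lincomb s0// t0// scaler0 addr0.
  by rewrite /lincomb (ss _ _ _ cx dx) (ts _ _ _ cx dx) sym2_density_actD.
- have [_ sT _ _] := hs; have [_ tT _ _] := ht.
  by move=> c x; rewrite /lincomb linearD linearZ /= sT tT.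
- move=> c; apply: continuous_in_subspaceT => x; rewrite inE => cx.
  apply: cvgD; last exact: test_section_continuous.
  by apply: cvgZ; [exact: cvg_cst|exact: test_section_continuous].
- by have [_ _ _ cs] := hs; have [_ _ _ ct] := ht; exact: compact_support_lincomb.
Qed.

Definition fun_mul (b : M -> R) (s : components M 'M[R]_n) : components M 'M[R]_n :=
  fun c x => b x *: s c x.

Lemma test_section_fun_mul b (s : components M 'M[R]_n) :
  continuous b -> test_section s -> test_section (fun_mul b s).
Proof.
move=> cb hs; have [[s0 ss] sT _ cs] := hs; split.
- split=> [c x cx|c d x cx dx]; first by rewrite /fun_mul s0// scaler0.
  rewrite /fun_mul (ss _ _ _ cx dx) /sym2_density_act.
  by rewrite -scalemxAr -scalemxAl !scalerA [b x * _]mulrC.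
- by move=> c x; rewrite /fun_mul linearZ /= sT.
- move=> c; apply: continuous_in_subspaceT => x; rewrite inE => cx.
  by apply: cvgZ; [exact: cb|exact: test_section_continuous].
- by apply: compact_support_sub cs => c x sx; rewrite /fun_mul sx scaler0.
Qed.

Lemma test_section0 : test_section ((fun _ _ => 0) : components M 'M[R]_n).
Proof.
split; first split => // c d x _ _.
- by rewrite /sym2_density_act mulmx0 mul0mx scaler0.
- by move=> c x; rewrite linear0.
- by move=> c; apply: continuous_in_subspaceT => x _; exact: cvg_cst.
- rewrite /compact_support (_ : [set x | _] = set0) ?closure0; last first.
    by apply/seteqP; split=> // x [c _ []].
  exact: compact0.
Qed.

Lemma jac_continuous c d x i j : dom_ c x -> dom_ d x ->
  {for x, continuous (fun z => jac c d z i j)}.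
Proof.
move=> cx dx; apply: continuous_entry.
apply: (@continuous_comp _ _ _ (coord_ c) (fun y => 'J (transition (atlas c) (atlas d)) y)).
  exact: coord_continuous_at.
by apply: loclip_continuous; exact: jacobian_transition_loclip.
Qed.

Lemma ler_norm_mulmx m p q (A : 'M[R]_(m, p)) (B : 'M[R]_(p, q)) :
  `|A *m B| <= p%:R * (`|A| * `|B|).
Proof.
apply: ler_norm_entries; first by rewrite !mulr_ge0.
move=> i j; rewrite mxE (le_trans (ler_norm_sum _ _ _))//.
have -> : p%:R * (`|A| * `|B|) = \sum_(k < p) `|A| * `|B|.
  by rewrite sumr_const card_ord mulr_natl.
by apply: ler_sum => k _; rewrite normrM ler_pM//; exact: ler_entry_norm.
Qed.

Lemma norm_trmx m p (A : 'M[R]_(m, p)) : `|A^T| <= `|A|.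
Proof. by apply: ler_norm_entries => // i j; rewrite mxE ler_entry_norm. Qed.

(** The change of components is given by the Jacobian of the transition map and
the inverse of its determinant, which are continuous, hence bounded on a compact
set. *)
Lemma sym2_components_bound c d (L : set M) :
  compact L -> L `<=` dom_ c `&` dom_ d ->
  exists2 B, 0 < B & forall (s : components M 'M[R]_n), test_section s ->
    forall x, L x -> `|s d x| <= B * `|s c x|.
Proof.
move=> cL Lcd.
have [B1 B10 JB1] : exists2 B : R, 0 < B &
    forall x, L x -> `| `|jac c d x| | <= B.
  apply: continuous_compact_bounded => // x /Lcd[cx dx].
  apply: (@continuous_comp _ _ _ (jac c d) (fun A : 'M[R]_n => `|A|)).
    by apply: continuous_mx => i j; exact: jac_continuous.
  exact: norm_continuous.
have [B2 B20 JB2] : exists2 B : R, 0 < B &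
    forall x, L x -> `|density_act 1 (jac c d x)| <= B.
  apply: continuous_compact_bounded => // x /Lcd[cx dx].
  have -> : (fun z => density_act 1 (jac c d z)) = (fun z => `|\det (jac c d z)|^-1).
    by apply/funext => z; rewrite /density_act powR_inv1.
  apply: cvgV; first by rewrite normr_eq0; exact: det_jac_neq0.
  apply: cvg_norm.
  apply: (@continuous_comp _ _ _ (coord_ c)
    (fun y => \det ('J (transition (atlas c) (atlas d)) y))).
    exact: coord_continuous_at.
  by apply: loclip_continuous; apply: loclip_det; exact: jacobian_transition_loclip.
exists (B2 * (n%:R * (n%:R * B1 * B1)) + 1).
  by rewrite ltr_wpDl// !mulr_ge0// ltW.
move=> s [[_ ss] _ _ _] x Lx; have [cx dx] := Lcd _ Lx.
rewrite (ss _ _ _ cx dx) /sym2_density_act.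
have := JB1 _ Lx; rewrite normr_id; have := JB2 _ Lx.
move: (jac c d x) (density_act _ _) (s c x) => J k A kB JB.
rewrite normrZ; apply: (@le_trans _ _ (B2 * (n%:R * (n%:R * B1 * B1)) * `|A|)); last first.
  by rewrite ler_wpM2r// lerDl.
rewrite -mulrA ler_pM// (le_trans (ler_norm_mulmx _ _))// -mulrA ler_wpM2l//.
have : `|J^T *m A| <= n%:R * (B1 * `|A|).
  rewrite (le_trans (ler_norm_mulmx _ _))// ler_wpM2l// ler_wpM2r//.
  exact: le_trans (norm_trmx _) JB.
have -> : n%:R * B1 * B1 * `|A| = (n%:R * (B1 * `|A|)) * B1 by ring.
by move=> ?; rewrite ler_pM.
Qed.

(** The definition of a measure bounds it by the components in several auxiliary
charts; on a compact set inside the chart [c] these are controlled by the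
components in [c]. *)
Lemma measure_chart_bound (mu : components M 'M[R]_n -> R) c (K : set M) :
  is_measure mu -> compact K -> K `<=` dom_ c ->
  exists2 C, 0 <= C & forall s (e : R), test_section s ->
    (forall d x, ~ K x -> s d x = 0) -> 0 <= e ->
    (forall x i j, K x -> `|s c x i j| <= e) -> `|mu s| <= C * e.
Proof.
move=> [_ /(_ K) h] cK Kc; have [N [d [L [C [Ld muC]]]]] := h cK.
have BP m : exists B, 0 < B /\ forall (s : components M 'M[R]_n), test_section s ->
    forall x, (K `&` L m) x -> `|s (d m) x| <= B * `|s c x|.
  have [||B B0 sB] := @sym2_components_bound c (d m) (K `&` L m).
  - have [cL _] := Ld m; apply: (subclosed_compact _ cK); last exact: subIsetl.
    by apply: closedI; apply: compact_closed => //; exact: carrier_hausdorff.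
  - by move=> x [/Kc ? /(Ld m).2].
  - by exists B.
have [B Bp] := choice BP.
have B0 : 0 <= \sum_m B m by apply: sumr_ge0 => m _; exact: ltW (Bp m).1.
exists (`|C| * \sum_m B m); first by rewrite mulr_ge0.
move=> s e hs sK e0 se; rewrite -mulrA.
apply: (@le_trans _ _ (C * ((\sum_m B m) * e))); last first.
  by rewrite ler_wpM2r ?ler_norm// mulr_ge0.
apply: muC => //; first by rewrite mulr_ge0.
move=> m x i j Lx; have [Kx|Kx] := pselect (K x); last first.
  by rewrite sK// mxE normr0 mulr_ge0.
rewrite (le_trans (ler_entry_norm _ _ _))//.
rewrite (le_trans ((Bp m).2 s hs x (conj Kx Lx)))// ler_pM ?(ltW (Bp m).1)//.
  rewrite (bigD1 m)//= lerDl sumr_ge0// => k _; exact: ltW (Bp k).1.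
by apply: ler_norm_entries => // k l; exact: se.
Qed.

End sections.

(** * Approximation by Lipschitz functions *)

Section lipschitz_approximation.
Variables (R : realType) (n : nat).
Implicit Types (f g : 'rV[R]_n -> R) (K : set 'rV[R]_n).

Lemma compact_uniform_continuity f K (e : R) :
  compact K -> continuous f -> 0 < e ->
  exists2 d : R, 0 < d &
    forall x y, K x -> `|x - y| < d -> `|f x - f y| <= e.
Proof.
move=> /compact_near_coveringP cK cf e0.
have H : forall x, K x -> \forall x' \near x & d \near (0 : R)^'+,
    forall y, `|x' - y| < d -> `|f x' - f y| <= e.
  move=> x Kx; have /cvgrPdist_le /(_ (e / 2)) := cf x.
  rewrite divr_gt0// => /(_ isT) /nbhs_ballP[d /= d0 xd].
  exists (ball x (d / 2), [set t : R | t < d / 2]).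
    split => /=; first by apply: nbhsx_ballx; rewrite divr_gt0.
    by apply: nbhs_right_lt; rewrite divr_gt0.
  move=> [x' t] /= [xx' td] y x'y.
  have xd' : ball x d x'.
    by apply: le_ball xx'; rewrite ler_pdivrMr// ler_peMr// ?(ltW d0)// (ler_nat R 1 2).
  have yd : ball x d y.
    move: xx'; rewrite -!ball_normE/= => xx'.
    rewrite -(subrKA x') (le_lt_trans (ler_normD _ _))// [ltRHS]splitr ltrD//.
    exact: lt_trans td.
  have -> : f x' - f y = (f x - f y) - (f x - f x') by ring.
  by rewrite (le_trans (ler_normB _ _))// [leRHS]splitr lerD//; apply: xd.
have Hd := cK R (0 : R)^'+
  (fun d x => forall y, `|x - y| < d -> `|f x - f y| <= e) _ H.
near (0 : R)^'+ => d; exists d => // x y Kx; move: x Kx y; near: d; exact: Hd.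
Unshelve. all: by end_near. Qed.

(** The largest [m]-Lipschitz function below [f]. For nonnegative [f] it lies
between 0 and [f], so the approximation does not enlarge the support. *)
Definition inf_convolution (m : R) f (x : 'rV[R]_n) : R :=
  inf [set f y + m * `|x - y| | y in setT].

Section inf_convolution.
Variables (m : R) (f : 'rV[R]_n -> R).
Hypotheses (m0 : 0 <= m) (f0 : forall y, 0 <= f y).

Let lb0 x : lbound [set f y + m * `|x - y| | y in setT] 0.
Proof. by move=> _ [y _ <-]; rewrite addr_ge0// mulr_ge0. Qed.

Let hasinf x : has_inf [set f y + m * `|x - y| | y in setT].
Proof. by split; [exists (f x + m * `|x - x|), x|exists 0; exact: lb0]. Qed.

Lemma inf_convolution_le x y : inf_convolution m f x <= f y + m * `|x - y|.
Proof. by apply: ge_inf; [exact: (hasinf x).2|exists y]. Qed.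

Lemma inf_convolution_ge x (a : R) :
  (forall y, a <= f y + m * `|x - y|) -> a <= inf_convolution m f x.
Proof.
by move=> ay; apply: lb_le_inf; [exact: (hasinf x).1|move=> _ [y _ <-]; exact: ay].
Qed.

Lemma inf_convolution_ge0 x : 0 <= inf_convolution m f x.
Proof. by apply: inf_convolution_ge => y; rewrite addr_ge0// mulr_ge0. Qed.

Lemma inf_convolution_le_self x : inf_convolution m f x <= f x.
Proof. by have := inf_convolution_le x x; rewrite subrr normr0 mulr0 addr0. Qed.

Lemma inf_convolution_lipschitz x y :
  `|inf_convolution m f x - inf_convolution m f y| <= m * `|x - y|.
Proof.
have H a b : inf_convolution m f a <= inf_convolution m f b + m * `|a - b|.
  rewrite -lerBlDr; apply: inf_convolution_ge => z.
  rewrite lerBlDr (le_trans (inf_convolution_le a z))// -addrA lerD2l.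
  rewrite -mulrDr ler_wpM2l// [leRHS]addrC.
  by have := ler_normD (a - b) (b - z); rewrite subrKA.
have := H x y; have := H y x; rewrite (distrC y) ler_norml => ? ?.
by apply/andP; split; lra.
Qed.

End inf_convolution.

(** Points nearer than [d] change [f] by at most [e]; for farther ones the penalty
[m * d] exceeds the maximum of [f]. *)
Lemma lipschitz_approx_ge0 f K (e : R) :
  compact K -> continuous f -> (forall y, ~ K y -> f y = 0) ->
  (forall y, 0 <= f y) -> 0 < e ->
  exists g, [/\ forall y, loclip g y, forall y, 0 <= g y <= f y &
                forall y, f y <= g y + e].
Proof.
move=> cK cf fK f0 e0.
have [d d0 fd] := compact_uniform_continuity cK cf e0.
have [B B0 fB] := continuous_compact_bounded cK (fun x _ => cf x).
have m0 : 0 < B / d by rewrite divr_gt0.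
exists (inf_convolution (B / d) f); split => y.
- exists (B / d) => //; exists setT; first exact: filterT.
  by move=> a b _ _; apply: inf_convolution_lipschitz => //; exact: ltW.
- by rewrite inf_convolution_ge0 ?inf_convolution_le_self// ltW.
- have [Ky|Ky] := pselect (K y); last first.
    by rewrite fK// addr_ge0 ?inf_convolution_ge0 ?ltW.
  rewrite -lerBlDr; apply: inf_convolution_ge => [|//|z]; first exact: ltW.
  have [yz|yz] := ltP `|y - z| d.
    have := fd _ _ Ky yz; rewrite ler_norml => /andP[_ h].
    have : 0 <= B / d * `|y - z| by rewrite mulr_ge0// ltW.
    lra.
  have : B <= B / d * `|y - z| by rewrite mulrAC ler_pdivlMr// ler_pM2l.
  have := fB _ Ky; rewrite ger0_norm//; have := f0 z; lra.
Qed.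

(** The positive and negative parts are approximated from below separately, which
keeps the approximation dominated by [f]. *)
Lemma lipschitz_approx f K (e : R) :
  compact K -> continuous f -> (forall y, ~ K y -> f y = 0) -> 0 < e ->
  exists g, [/\ forall y, loclip g y, forall y, `|g y| <= `|f y| &
                forall y, `|f y - g y| <= e].
Proof.
move=> cK cf fK e0.
have cpos : continuous (fun y => Num.max (f y) 0).
  by move=> y; apply: continuous_max; [exact: cf|exact: cst_continuous].
have cneg : continuous (fun y => Num.max (- f y) 0).
  move=> y; apply: (@continuous_max _ _ (fun y => - f y) (fun=> 0)).
    exact: (cvgN (cf y)).
  exact: cst_continuous.
have [|y|p [lp p0 pf]] := @lipschitz_approx_ge0 _ K e cK cpos _ _ e0.
- by move=> y /fK ->; rewrite maxxx.
- by rewrite le_max lexx orbT.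
have [|y|q [lq q0 qf]] := @lipschitz_approx_ge0 _ K e cK cneg _ _ e0.
- by move=> y /fK ->; rewrite oppr0 maxxx.
- by rewrite le_max lexx orbT.
exists (fun y => p y - q y); split => y.
- exact: loclipB.
- have := p0 y; have := q0 y.
  have [fy|fy] := leP 0 (f y).
    rewrite (max_r (_ : - f y <= 0)) ?oppr_le0// => q0y /andP[p1 p2].
    have -> : q y = 0 by apply/eqP; rewrite eq_le andbC.
    by rewrite subr0 !ger0_norm.
  rewrite (max_l (_ : 0 <= - f y)) ?oppr_ge0 ?(ltW fy)// => /andP[q1 q2] p0y.
  have -> : p y = 0 by apply/eqP; rewrite eq_le andbC.
  by rewrite sub0r normrN ger0_norm// ltr0_norm.
- have := p0 y; have := q0 y; have := pf y; have := qf y.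
  have [fy|fy] := leP 0 (f y).
    rewrite (max_r (_ : - f y <= 0)) ?oppr_le0// => _ pe q0y /andP[p1 p2].
    have -> : q y = 0 by apply/eqP; rewrite eq_le andbC.
    rewrite subr0 ger0_norm; lra.
  rewrite (max_l (_ : 0 <= - f y)) ?oppr_ge0 ?(ltW fy)// => qe _ /andP[q1 q2] p0y.
  have -> : p y = 0 by apply/eqP; rewrite eq_le andbC.
  rewrite ler_norml; apply/andP; split; lra.
Qed.

End lipschitz_approximation.

(** * Functionals that are nonnegative on squares *)

Section coordinate_half_densities.
Variables (R : realType) (n : nat) (M : C11_manifold R n).
Implicit Types (c d e : chart_index M) (x : M).
#[local] Opaque jac.

Definition coord_hd c (g : 'rV[R]_n -> R) (j : 'I_n) : components M 'rV[R]_n :=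
  chart_section (@half_density_vector_act R n) c (fun y => g y *: delta_mx 0 j).

Definition sym_basis (i j : 'I_n) : 'M[R]_n := 2^-1 *: (delta_mx i j + delta_mx j i).

Lemma coord_hdE c g j d x :
  coord_hd c g j d x = g (coord_ c x) *: coord_hd c (fun=> 1) j d x.
Proof.
rewrite /coord_hd /chart_section; case: asboolP => _; last by rewrite scaler0.
rewrite /half_density_vector_act /tangent_act scale1r -scalemxAl !scalerA.
by rewrite mulrC.
Qed.

Lemma coord_hd_self c g j x : dom_ c x ->
  coord_hd c g j c x = g (coord_ c x) *: delta_mx 0 j.
Proof.
by move=> cx; rewrite /coord_hd chart_section_self//;
  exact: loclip_half_density_vector_act.
Qed.

(** Products of these half-densities depend on the coefficients only through their
product: a factor can be moved from one side to the other. *)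
Lemma sym_coord_hdE c g h i j : sym_prod (coord_hd c g i) (coord_hd c h j) =
  fun d x => (g (coord_ c x) * h (coord_ c x)) *:
    sym_prod (coord_hd c (fun=> 1) i) (coord_hd c (fun=> 1) j) d x.
Proof.
apply/funext => d; apply/funext => x; apply/matrixP => k l; rewrite !mxE.
rewrite (coord_hdE _ g) (coord_hdE _ h) !mxE; ring.
Qed.

Lemma eq_sym_coord_hd c g h g' h' i j : (forall y, g y * h y = g' y * h' y) ->
  sym_prod (coord_hd c g i) (coord_hd c h j) =
  sym_prod (coord_hd c g' i) (coord_hd c h' j).
Proof.
move=> gh; rewrite sym_coord_hdE [RHS]sym_coord_hdE.
by apply/funext => d; apply/funext => x; rewrite gh.
Qed.

Lemma sym_coord_hd_self c g h i j x : dom_ c x ->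
  sym_prod (coord_hd c g i) (coord_hd c h j) c x =
  (g (coord_ c x) * h (coord_ c x)) *: sym_basis i j.
Proof.
move=> cx; rewrite sym_prodE !coord_hd_self// ![(_ *: _)^T]linearZ /= !trmx_delta.
rewrite -!scalemxAl -!scalemxAr !mul_delta_mx !scalerA /sym_basis.
rewrite [h _ * g _]mulrC -scalerDr !scalerA; congr (_ *: _); exact: mulrC.
Qed.

Lemma sym_coord_hd_out c g h i j d x (K : set 'rV[R]_n) :
  (forall y, ~ K y -> g y = 0) -> ~ (param_ c @` K) x ->
  sym_prod (coord_hd c g i) (coord_hd c h j) d x = 0.
Proof.
move=> gK xK; rewrite sym_coord_hdE.
have [cx|cx] := pselect (dom_ c x).
  rewrite gK ?mul0r ?scale0r// => Kx; apply: xK.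
  by exists (coord_ c x) => //; rewrite coordK.
apply/matrixP => k l; rewrite !mxE /coord_hd /chart_section.
by rewrite asboolF ?mxE ?mul0r ?addr0 ?mulr0// => -[].
Qed.

Lemma lipschitz_coord_hd c g j (K : set 'rV[R]_n) :
  compact K -> K `<=` im_ c -> (forall y, ~ K y -> g y = 0) ->
  (forall y, loclip g y) -> lipschitz_half_density (coord_hd c g j).
Proof.
move=> cK Kc gK lg; apply: lipschitz_half_density_chart_section cK Kc _ _.
  by move=> y /gK ->; rewrite scale0r.
by move=> y; apply: loclipZ => //; exact: loclip_cst.
Qed.

Lemma norm_sym_basis i j k l : `|sym_basis i j k l| <= 1.
Proof.
rewrite !mxE; case: (_ && _); case: (_ && _); rewrite ?mulr1n ?mulr0n.
all: rewrite ger0_norm; lra.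
Qed.

Lemma sym_prodC (V W : components M 'rV[R]_n) : sym_prod V W = sym_prod W V.
Proof.
apply/funext => c; apply/funext => x; apply/matrixP => i j; rewrite !mxE; ring.
Qed.

Lemma measure_sym_quadratic mu (V W : components M 'rV[R]_n) t :
  is_measure mu -> lipschitz_half_density V -> lipschitz_half_density W ->
  mu (sym_prod (lincomb t W V) (lincomb t W V)) =
  t ^+ 2 * mu (sym_prod W W) + (2 * t * mu (sym_prod V W) + mu (sym_prod V V)).
Proof.
move=> [muL _] hV hW.
have -> : sym_prod (lincomb t W V) (lincomb t W V) =
    lincomb (t ^+ 2) (sym_prod W W)
      (lincomb (2 * t) (sym_prod V W) (sym_prod V V)).
  apply/funext => c; apply/funext => x; apply/matrixP => i j; rewrite !mxE; by field.
have tVW := test_section_sym_prod hV hW.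
have tVV := test_section_sym_prod hV hV.
have tWW := test_section_sym_prod hW hW.
by rewrite !muL//; exact: test_section_lincomb.
Qed.

Lemma measure0 mu : is_measure mu ->
  mu ((fun _ _ => 0) : components M 'M[R]_n) = 0.
Proof.
move=> [/(_ 1 _ _ (test_section0 M) (test_section0 M)) + _].
have -> : lincomb 1 (fun _ _ => 0) (fun _ _ => 0) =
    (fun _ _ => 0) :> components M 'M[R]_n.
  by apply/funext => c; apply/funext => x; rewrite /lincomb scaler0 addr0.
by move=> /eqP; rewrite mul1r -subr_eq subrr eq_sym => /eqP.
Qed.

Lemma test_section_sum (I : Type) (r : seq I) (s : I -> components M 'M[R]_n) :
  (forall i, test_section (s i)) -> test_section (fun c x => \sum_(i <- r) s i c x).
Proof.
move=> hs; elim: r => [|i r ih].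
  have -> : (fun c x => \sum_(i <- [::]) s i c x) = fun _ _ => 0.
    by apply/funext => c; apply/funext => x; rewrite big_nil.
  exact: test_section0.
have -> : (fun c x => \sum_(j <- i :: r) s j c x) =
    lincomb 1 (s i) (fun c x => \sum_(j <- r) s j c x).
  apply/funext => c; apply/funext => x.
  by rewrite /lincomb big_cons scale1r.
exact: test_section_lincomb.
Qed.

Lemma measure_sum mu (I : Type) (r : seq I) (s : I -> components M 'M[R]_n) :
  is_measure mu -> (forall i, test_section (s i)) ->
  mu (fun c x => \sum_(i <- r) s i c x) = \sum_(i <- r) mu (s i).
Proof.
move=> hmu hs; elim: r => [|i r ih].
  have -> : (fun c x => \sum_(i <- [::]) s i c x) = fun _ _ => 0.
    by apply/funext => c; apply/funext => x; rewrite big_nil.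
  by rewrite big_nil measure0.
have -> : (fun c x => \sum_(j <- i :: r) s j c x) =
    lincomb 1 (s i) (fun c x => \sum_(j <- r) s j c x).
  apply/funext => c; apply/funext => x.
  by rewrite /lincomb big_cons scale1r.
have [muL _] := hmu; rewrite muL ?mul1r ?big_cons ?ih//.
exact: test_section_sum.
Qed.

Section positive_functional.
Variables (mu : components M 'M[R]_n -> R) (c : chart_index M).
Variables (y0 : 'rV[R]_n) (r : R).
Hypotheses (hmu : is_measure mu).
Hypothesis mu_ge0 : forall V, lipschitz_half_density V -> 0 <= mu (sym_prod V V).
Hypotheses (r0 : 0 < r) (Kc : cball y0 (2 * r) `<=` im_ c).
Local Notation K := (cball y0 r).
Local Notation eta := (bump y0 r).

(** The Lipschitz coefficients supported in the ball where the cutoff [eta] is 1, so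
that [g * eta = g]. *)
Definition admissible (g : 'rV[R]_n -> R) :=
  (forall y, loclip g y) /\ (forall y, ~ cball y0 r y -> g y = 0).

Let eta_hd j : lipschitz_half_density (coord_hd c eta j).
Proof.
apply: (lipschitz_coord_hd j (@compact_cball _ _ y0 (2 * r)) Kc).
  by move=> y; exact: bump0.
by move=> y; exact: loclip_bump.
Qed.

Let Kc' : K `<=` im_ c.
Proof. exact: subset_trans (cball_double r0) Kc. Qed.

Lemma admissible_hd g j : admissible g -> lipschitz_half_density (coord_hd c g j).
Proof.
by move=> [lg gK]; exact: (lipschitz_coord_hd j (@compact_cball _ _ y0 r) Kc').
Qed.

Lemma admissible_mul_bump g y : admissible g -> g y * eta y = g y.
Proof.
move=> [_ gK]; have [Ky|Ky] := pselect (K y); last by rewrite gK// mul0r.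
by rewrite bump1// mulr1.
Qed.

Lemma admissible_sqr g : admissible g -> admissible (fun y => g y * g y).
Proof.
move=> [lg gK]; split; first by move=> y; exact: loclipM.
by move=> y /gK ->; rewrite mul0r.
Qed.

Local Notation p j := (mu (sym_prod (coord_hd c eta j) (coord_hd c eta j))).
Local Notation m g i j := (mu (sym_prod (coord_hd c g i) (coord_hd c eta j))).

(** Let [B] be the supremum of the left-hand sides, finite since [mu] is a measure.
The squares of [(eta + g) e_j] and [(eta - g) e_j] are
[eta^2 e_j e_j +- 2 g e_j e_j + g^2 e_j e_j], and [g^2] is again admissible and
bounded by 1. Hence [2 |mu (g e_j e_j)| <= p j + B] for all [g], so
[2 B <= p j + B]. Writing [eta^2 - g] itself as a square would be more direct, but
square roots of Lipschitz functions need not be Lipschitz. *)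
Lemma positive_diag_bound g j : admissible g -> (forall y, `|g y| <= 1) ->
  `|m g j j| <= p j.
Proof.
pose B := sup [set `|m g j j| | g in [set g | admissible g /\ forall y, `|g y| <= 1]].
have [C C0 muC] : exists2 C, 0 <= C & forall g, admissible g ->
    (forall y, `|g y| <= 1) -> `|m g j j| <= C.
  have cKM : compact (param_ c @` K).
    exact: (compact_param_image (@compact_cball _ _ y0 r) Kc').
  have [|C C0 muC] := measure_chart_bound (c := c) hmu cKM.
    by move=> _ [y Ky <-]; apply: param_dom; exact: Kc'.
  exists C => // {}g ag g1; rewrite -[C]mulr1; apply: muC => //.
  - by apply: test_section_sym_prod; [exact: admissible_hd|exact: eta_hd].
  - by move=> d x xK; exact: (sym_coord_hd_out _ _ _ _ ag.2).
  - move=> x k l [y Ky <-].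
    rewrite sym_coord_hd_self; last by apply: param_dom; exact: Kc'.
    rewrite paramK; last exact: Kc'.
    rewrite admissible_mul_bump// mxE normrM -[leRHS]mulr1 ler_pM//.
    exact: norm_sym_basis.
have hasB : has_sup [set `|m g j j| | g in
    [set g | admissible g /\ forall y, `|g y| <= 1]].
  split.
    exists `|m (fun=> 0) j j|, (fun=> 0) => //=; split; last by rewrite normr0.
    by split => // y; exact: loclip_cst.
  by exists C => _ [h [ag g1] <-]; exact: muC.
have leB h : admissible h -> (forall y, `|h y| <= 1) -> `|m h j j| <= B.
  by move=> ah h1; apply: sup_upper_bound => //; exists h.
have step h : admissible h -> (forall y, `|h y| <= 1) ->
    2 * `|m h j j| <= p j + B.
  move: g => _; move: h => g ag g1; have hg := admissible_hd j ag.
  have gg : mu (sym_prod (coord_hd c g j) (coord_hd c g j)) <= B.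
    have -> : sym_prod (coord_hd c g j) (coord_hd c g j) =
        sym_prod (coord_hd c (fun y => g y * g y) j) (coord_hd c eta j).
      by apply: eq_sym_coord_hd => y; rewrite -mulrA admissible_mul_bump.
    apply: le_trans (ler_norm _) _; apply: leB; first exact: admissible_sqr.
    by move=> y; rewrite normrM -[leRHS]mulr1 ler_pM.
  have h1 := mu_ge0 (lipschitz_half_density_lincomb 1 hg (eta_hd j)).
  have h2 := mu_ge0 (lipschitz_half_density_lincomb (-1) hg (eta_hd j)).
  move: h1 h2; rewrite !measure_sym_quadratic//.
  rewrite (sym_prodC (coord_hd c eta j)) => h1 h2.
  by case: (lerP 0 (m g j j)) => m0;
    [rewrite ger0_norm//|rewrite ltr0_norm//]; lra.
have Bp : B <= p j.
  suff : B <= (p j + B) / 2 by lra.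
  apply: ge_sup; first exact: hasB.1.
  by move=> _ [h [ag g1] <-]; rewrite ler_pdivlMr// mulrC; exact: step.
by move=> ag g1; apply: le_trans Bp; exact: leB.
Qed.

(** Expand the squares of [eta e_j + g e_i] and [eta e_j - g e_i]; the term in [g^2]
is controlled by [positive_diag_bound]. *)
Lemma positive_cross_bound g i j : admissible g -> (forall y, `|g y| <= 1) ->
  `|m g i j| <= \sum_k p k.
Proof.
move=> ag g1; have hg := admissible_hd i ag.
have p_ge0 k : 0 <= p k by exact: mu_ge0.
have gg : mu (sym_prod (coord_hd c g i) (coord_hd c g i)) <= p i.
  have -> : sym_prod (coord_hd c g i) (coord_hd c g i) =
      sym_prod (coord_hd c (fun y => g y * g y) i) (coord_hd c eta i).
    by apply: eq_sym_coord_hd => y; rewrite -mulrA admissible_mul_bump.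
  apply: le_trans (ler_norm _) _; apply: positive_diag_bound.
    exact: admissible_sqr.
  by move=> y; rewrite normrM -[leRHS]mulr1 ler_pM.
have h1 := mu_ge0 (lipschitz_half_density_lincomb 1 hg (eta_hd j)).
have h2 := mu_ge0 (lipschitz_half_density_lincomb (-1) hg (eta_hd j)).
have pS k : p k <= \sum_k p k by rewrite (bigD1 k)//= lerDl sumr_ge0.
move: h1 h2 (pS i) (pS j); rewrite !measure_sym_quadratic//.
rewrite (sym_prodC (coord_hd c eta j)) => h1 h2.
by case: (lerP 0 (m g i j)) => m0;
  [rewrite ger0_norm//|rewrite ltr0_norm//]; lra.
Qed.

End positive_functional.

Section approximation.
Variables (c : chart_index M) (y0 : 'rV[R]_n) (r : R).
Hypotheses (r0 : 0 < r) (Kc : cball y0 (2 * r) `<=` im_ c).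
Local Notation K := (cball y0 r).
Local Notation eta := (bump y0 r).
Local Notation KM := (param_ c @` cball y0 r).

Let Kc' : K `<=` im_ c.
Proof. exact: subset_trans (cball_double r0) Kc. Qed.

(** The test section with coefficients [g], written as a sum of products of
half-densities; the second factor carries the cutoff, which is 1 where the
coefficients live. *)
Definition coord_comb (g : 'I_n * 'I_n -> 'rV[R]_n -> R) : components M 'M[R]_n :=
  fun d x => \sum_p sym_prod (coord_hd c (g p) p.1) (coord_hd c eta p.2) d x.

Lemma test_section_coord_comb_term g (p : 'I_n * 'I_n) : admissible y0 r g ->
  test_section (sym_prod (coord_hd c g p.1) (coord_hd c eta p.2)).
Proof.
move=> ag; apply: test_section_sym_prod; first exact: (admissible_hd r0 Kc).
apply: (lipschitz_coord_hd p.2 (@compact_cball _ _ y0 (2 * r)) Kc).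
  by move=> y; exact: bump0.
by move=> y; exact: loclip_bump.
Qed.

Lemma test_section_coord_comb g : (forall p, admissible y0 r (g p)) ->
  test_section (coord_comb g).
Proof. by move=> ag; apply: test_section_sum => p; exact: test_section_coord_comb_term. Qed.

Lemma coord_comb_out g d x : (forall p, admissible y0 r (g p)) -> ~ KM x -> coord_comb g d x = 0.
Proof.
move=> ag xK; rewrite /coord_comb big1// => p _.
exact: (sym_coord_hd_out _ _ _ _ (ag p).2).
Qed.

Lemma coord_comb_self g y k l : (forall p, admissible y0 r (g p)) -> K y ->
  coord_comb g c (param_ c y) k l = 2^-1 * (g (k, l) y + g (l, k) y).
Proof.
move=> ag Ky; have cy := Kc' Ky; have cpy := param_dom cy.
have -> : coord_comb g c (param_ c y) = 2^-1 *:
    ((\matrix_(i, j) g (i, j) y) + (\matrix_(i, j) g (j, i) y)).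
  rewrite [X in X + _]matrix_sum_delta [X in _ + X]matrix_sum_delta.
  rewrite [X in _ + X]exchange_big /= !pair_bigA/= -big_split/= scaler_sumr.
  apply: eq_bigr => -[i j] _ /=.
  rewrite sym_coord_hd_self// paramK// (admissible_mul_bump r0 _ (ag (i, j))).
  by rewrite /sym_basis !mxE scalerA [_ * 2^-1]mulrC -scalerA scalerDr.
by rewrite !mxE.
Qed.

(** The coefficients of [S], extended by zero to the whole coordinate space, are
continuous with support in the ball, and [lipschitz_approx] applies to each. *)
Lemma test_section_approx S (e : R) : test_section S ->
  (forall d x, ~ KM x -> S d x = 0) -> 0 < e ->
  exists g, [/\ forall p, admissible y0 r (g p),
    forall d : R, 0 <= d -> (forall x i j, KM x -> `|S c x i j| <= d) ->
      forall p y, `|g p y| <= d &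
    forall x i j, KM x -> `|S c x i j - coord_comb g c x i j| <= e].
Proof.
move=> hS SK e0.
pose f (p : 'I_n * 'I_n) y := if `[< K y >] then S c (param_ c y) p.1 p.2 else 0.
have fE p y : im_ c y -> f p y = S c (param_ c y) p.1 p.2.
  move=> cy; rewrite /f; case: asboolP => // Ky; rewrite SK ?mxE// => -[z Kz].
  move=> /(congr1 (coord_ c)); rewrite !paramK//; last exact: Kc'.
  by move=> zy; apply: Ky; rewrite -zy.
have fc p : continuous (f p).
  move=> y; have [cy|cy] := pselect (im_ c y); last first.
    have Ky : nbhs y (~` K).
      apply: open_nbhs_nbhs; split; last by move=> /Kc'.
      apply: closed_openC; apply: compact_closed; first exact: norm_hausdorff.
      exact: compact_cball.
    have f0 : \near y, f p y = 0.
      by apply: filterS Ky => z Kz; rewrite /f asboolF.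
    apply: (@loclip_continuous _ _ R (f p)).
    apply: (@loclip_near_eq _ _ R (fun=> 0)); last exact: loclip_cst.
    by apply: filterS f0 => z ->.
  have cS : {for y, continuous ((fun x => S c x p.1 p.2) \o param_ c)}.
    apply: continuous_comp; first exact: param_continuous_at.
    by apply: continuous_entry; apply: test_section_continuous => //; exact: param_dom.
  have ny : \near y, ((fun x => S c x p.1 p.2) \o param_ c) y = f p y.
    have : nbhs y (im_ c) by apply: open_nbhs_nbhs; split=> //; exact: coord_open.
    by apply: filterS => z cz; rewrite fE.
  rewrite /continuous_at (fE _ _ cy).
  by apply: cvg_trans cS; exact: near_eq_cvg ny.
have gP p : exists g, [/\ forall y, loclip g y, forall y, `|g y| <= `|f p y| &
    forall y, `|f p y - g y| <= e].
  apply: (@lipschitz_approx _ _ (f p) K) => //; first exact: compact_cball.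
  by move=> y Ky; rewrite /f asboolF.
have [g gp] := choice gP.
have ag p : admissible y0 r (g p).
  have [lg gf _] := gp p; split=> // y Ky; apply/eqP.
  by rewrite -normr_le0 (le_trans (gf y))// /f asboolF// normr0.
exists g; split=> //.
  move=> d d0 Sd p y; have [_ gf _] := gp p; rewrite (le_trans (gf y))// /f.
  case: asboolP => Ky; last by rewrite normr0.
  by apply: Sd; exists y.
move=> _ i j [y Ky <-]; rewrite coord_comb_self//.
have -> : S c (param_ c y) i j = 2^-1 * (f (i, j) y + f (j, i) y).
  rewrite !fE /=; try exact: Kc'.
  have [_ sT _ _] := hS; have := sT c (param_ c y).
  by move=> /matrixP/(_ i j); rewrite mxE => ->; field.
have [_ _ h1] := gp (i, j); have [_ _ h2] := gp (j, i).
move: (h1 y) (h2 y); rewrite !ler_norml => /andP[? ?] /andP[? ?].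
by apply/andP; split; lra.
Qed.

(** The bound is in terms of finitely many values of [mu] on squares, which is what
makes it uniform along a sequence of functionals that converges on products. It
holds for the Lipschitz approximations of [S] by [positive_cross_bound], and
passes to [S] because [mu] is a measure. *)
Lemma positive_bound mu S (d : R) :
  is_measure mu ->
  (forall V, lipschitz_half_density V -> 0 <= mu (sym_prod V V)) ->
  test_section S -> (forall d x, ~ KM x -> S d x = 0) -> 0 < d ->
  (forall x i j, KM x -> `|S c x i j| <= d) ->
  `|mu S| <= d * (#|{: 'I_n * 'I_n}|%:R *
    \sum_k mu (sym_prod (coord_hd c eta k) (coord_hd c eta k))).
Proof.
move=> hmu mu_ge0 hS SK d0 Sd; set P := \sum_k _.
have cKM : compact KM by exact: (compact_param_image (@compact_cball _ _ y0 r) Kc').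
have KMd : KM `<=` dom_ c by move=> _ [y Ky <-]; apply: param_dom; exact: Kc'.
have [C C0 muC] := measure_chart_bound hmu cKM KMd.
apply/ler_addgt0Pr => e e0.
have e'0 : 0 < e / (C + 1) by rewrite divr_gt0// ltr_wpDl.
have [g [ag gd Sg]] := test_section_approx hS SK e'0.
have hc := test_section_coord_comb ag.
have [muL _] := hmu.
have -> : S = lincomb 1 (lincomb (-1) (coord_comb g) S) (coord_comb g).
  by apply/funext => c'; apply/funext => x; rewrite /lincomb scaleN1r scale1r addrC addNKr.
have hl := test_section_lincomb (-1) hc hS.
rewrite muL// mul1r addrC (le_trans (ler_normD _ _))// lerD//.
  rewrite /coord_comb measure_sum//; last by move=> p; exact: test_section_coord_comb_term.
  rewrite (le_trans (ler_norm_sum _ _ _))//.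
  have -> : d * (#|{: 'I_n * 'I_n}|%:R * P) = \sum_(p : 'I_n * 'I_n) d * P.
    by rewrite sumr_const mulrCA mulr_natl.
  apply: ler_sum => p _.
  have gdE : coord_hd c (g p) p.1 = lincomb d (coord_hd c (fun y => d^-1 * g p y) p.1)
      (fun _ _ => 0).
    apply/funext => c'; apply/funext => x; rewrite /lincomb addr0.
    by rewrite (coord_hdE _ (g p)) (coord_hdE _ (fun y => d^-1 * g p y)) scalerA mulVKf ?gt_eqF.
  have ad : admissible y0 r (fun y => d^-1 * g p y).
    split=> [y|y /(ag p).2 ->]; last by rewrite mulr0.
    by apply: loclipM; [exact: loclip_cst|exact: (ag p).1].
  have -> : sym_prod (coord_hd c (g p) p.1) (coord_hd c eta p.2) = lincomb d
      (sym_prod (coord_hd c (fun y => d^-1 * g p y) p.1) (coord_hd c eta p.2))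
      (fun _ _ => 0).
    apply/funext => c'; apply/funext => x; apply/matrixP => i j.
    by rewrite gdE !mxE; ring.
  rewrite muL ?measure0//; [|exact: test_section_coord_comb_term|exact: test_section0].
  rewrite addr0 normrM (gtr0_norm d0) ler_pM2l//.
  apply: (positive_cross_bound hmu mu_ge0 r0 Kc) => // y.
  rewrite normrM gtr0_norm ?invr_gt0// ler_pdivrMl// mulr1.
  by apply: gd => //; exact: ltW.
apply: (@le_trans _ _ (C * (e / (C + 1)))).
  apply: muC => //.
  - by move=> d' x xK; rewrite /lincomb coord_comb_out// SK// scaler0 addr0.
  - exact: ltW.
  - by move=> x i j Kx; rewrite !mxE mulN1r addrC; exact: Sg.
by rewrite mulrCA ler_piMr ?(ltW e0)// ler_pdivrMr ?mul1r ?lerDl// ltr_wpDl.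
Qed.

End approximation.

End coordinate_half_densities.

(** * Weak convergence from convergence on products of half-densities *)

Lemma cvg_fin_sum (R : realType) (I : Type) (s : seq I) (f : I -> nat -> R)
    (a : I -> R) : (forall i, f i @ \oo --> a i) ->
  (fun k => \sum_(i <- s) f i k) @ \oo --> \sum_(i <- s) a i.
Proof.
move=> fa; elim: s => [|i s ih].
  by rewrite big_nil; under eq_fun do rewrite big_nil; exact: cvg_cst.
by rewrite big_cons; under eq_fun do rewrite big_cons; exact: cvgD.
Qed.

Section weak_convergence.
Variables (R : realType) (n : nat) (M : C11_manifold R n).
Implicit Types (c d e : chart_index M) (x : M).
#[local] Opaque jac.

Lemma is_measureD (mu nu : components M 'M[R]_n -> R) :
  is_measure mu -> is_measure nu -> is_measure (fun s => mu s + nu s).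
Proof.
move=> [muL muK] [nuL nuK]; split=> [a s t hs ht|K cK].
  by rewrite muL// nuL//; ring.
have [N1 [c1 [L1 [C1 [L1d C1b]]]]] := muK K cK.
have [N2 [c2 [L2 [C2 [L2d C2b]]]]] := nuK K cK.
exists (N1 + N2)%N,
  (fun m => match fintype.split m with inl a => c1 a | inr b => c2 b end),
  (fun m => match fintype.split m with inl a => L1 a | inr b => L2 b end), (C1 + C2).
split; first by move=> m; case: (fintype.split m) => a; [exact: L1d|exact: L2d].
move=> s e hs sK e0 se; rewrite mulrDl (le_trans (ler_normD _ _))// lerD//.
- apply: C1b => // m x i j Lx.
  by have := se (lshift N2 m) x i j; rewrite (unsplitK (inl m)); exact.
- apply: C2b => // m x i j Lx.
  by have := se (rshift N1 m) x i j; rewrite (unsplitK (inr m)); exact.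
Qed.

Definition bumpM c y0 (r : R) x : R :=
  if `[< dom_ c x >] then bump y0 r (coord_ c x) else 0.

Lemma continuous_bumpM c y0 r : 0 < r -> cball y0 (2 * r) `<=` im_ c ->
  continuous (bumpM c y0 r).
Proof.
move=> r0 Kc x; have [cx|cx] := pselect (dom_ c x).
  have nx : \near x, (bump y0 r \o coord_ c) x = bumpM c y0 r x.
    by have := nbhs_dom cx; apply: filterS => z cz; rewrite /bumpM asboolT.
  have cB : {for x, continuous (bump y0 r \o coord_ c)}.
    apply: continuous_comp; first exact: coord_continuous_at.
    by apply: loclip_continuous; exact: loclip_bump.
  have fx : bumpM c y0 r x = bump y0 r (coord_ c x) by rewrite /bumpM asboolT.
  rewrite /continuous_at fx; apply: cvg_trans cB; exact: near_eq_cvg nx.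
have xK : nbhs x (~` (param_ c @` cball y0 (2 * r))).
  apply: open_nbhs_nbhs; split.
    apply: closed_openC; apply: closed_param_image => //; exact: compact_cball.
  by move=> [y /Kc cy yx]; apply: cx; rewrite -yx; exact: param_dom.
have nx : \near x, (fun=> 0 : R) x = bumpM c y0 r x.
  apply: filterS xK => z zK; rewrite /bumpM; case: asboolP => // cz.
  rewrite bump0// => Kz; apply: zK; exists (coord_ c z) => //; exact: coordK.
have fx : bumpM c y0 r x = 0 by rewrite /bumpM asboolF.
rewrite /continuous_at fx.
apply: cvg_trans (near_eq_cvg nx) _; exact: cvg_cst.
Qed.

Lemma bumpM1 c y0 r x : 0 < r -> cball y0 r `<=` im_ c ->
  (param_ c @` cball y0 r) x -> bumpM c y0 r x = 1.
Proof.
move=> r0 Kc [y Ky <-]; have cy := Kc _ Ky.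
by rewrite /bumpM asboolT ?paramK ?bump1//; exact: param_dom.
Qed.

Lemma bumpM0 c y0 r x : 0 < r ->
  ~ (param_ c @` cball y0 (2 * r)) x -> bumpM c y0 r x = 0.
Proof.
move=> r0 xK; rewrite /bumpM; case: asboolP => // cx; apply: bump0 => // Kx.
by apply: xK; exists (coord_ c x) => //; exact: coordK.
Qed.

Lemma nbhs_param_cball c x r : dom_ c x -> 0 < r ->
  nbhs x (param_ c @` cball (coord_ c x) r).
Proof.
move=> cx r0; have cc := coord_continuous_at cx.
have xb : nbhs (coord_ c x) (ball (coord_ c x) r) by exact: nbhsx_ballx.
apply: filterS (filterI (nbhs_dom cx) (cc _ xb)) => z [cz zr].
exists (coord_ c z); last exact: coordK.
by move: zr; rewrite /= -ball_normE/= distrC => /ltW.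
Qed.

Variables (mu : nat -> components M 'M[R]_n -> R) (nu h : components M 'M[R]_n -> R).
Hypotheses (hmu : forall r, is_measure (mu r)) (hnu : is_measure nu)
  (hh : is_measure h).
Hypothesis mu_lb : forall r V, lipschitz_half_density V ->
  - h (sym_prod V V) <= mu r (sym_prod V V).
Hypothesis mu_cvg : forall V W, lipschitz_half_density V ->
  lipschitz_half_density W ->
  (fun r => mu r (sym_prod V W)) @ \oo --> nu (sym_prod V W).

(** Write [S = Z + C] with [C] a finite sum of products of Lipschitz half-densities,
where convergence is assumed, and [Z] smaller than [t]. By [positive_bound] for
[mu k + h], the value of [mu k] at [Z] is at most a constant times [t] for all
large [k]. *)
Lemma weak_cvg_local c y0 (r : R) S : 0 < r -> cball y0 (2 * r) `<=` im_ c ->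
  test_section S -> (forall d x, ~ (param_ c @` cball y0 r) x -> S d x = 0) ->
  (fun k => mu k S) @ \oo --> nu S.
Proof.
move=> r0 Kc hS SK.
have Kc' : cball y0 r `<=` im_ c by exact: subset_trans (cball_double r0) Kc.
set KM := param_ c @` cball y0 r.
have cKM : compact KM by exact: (compact_param_image (@compact_cball _ _ y0 r) Kc').
have KMd : KM `<=` dom_ c by move=> _ [y Ky <-]; apply: param_dom; exact: Kc'.
have [A A0 hA] := measure_chart_bound hh cKM KMd.
have [B B0 nuB] := measure_chart_bound hnu cKM KMd.
pose E k := sym_prod (coord_hd c (bump y0 r) k) (coord_hd c (bump y0 r) k).
have hE k : lipschitz_half_density (coord_hd c (bump y0 r) k).
  apply: (lipschitz_coord_hd k (@compact_cball _ _ y0 (2 * r)) Kc).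
    by move=> y; exact: bump0.
  by move=> y; exact: loclip_bump.
pose P k := \sum_i (mu k (E i) + h (E i)).
pose Q := \sum_i (nu (E i) + h (E i)).
have PQ : P @ \oo --> Q.
  apply: (@cvg_fin_sum _ _ _ (fun i k => mu k (E i) + h (E i))) => i.
  apply: cvgD; last exact: cvg_cst.
  exact: mu_cvg.
have P_le : \forall k \near \oo, P k <= `|Q| + 1.
  have /cvgrPdist_le/(_ 1 ltr01) := PQ; apply: filterS => k.
  by rewrite ler_norml => /andP[h1 h2]; have := ler_norm Q; lra.
set N : R := #|{: 'I_n * 'I_n}|%:R.
apply/cvgrPdist_le => e e0.
(* [t * D] bounds the three contributions of [Z] computed below. *)
pose D := N * (`|Q| + 1) + A + B + 1.
have N0 : 0 <= N * (`|Q| + 1) by rewrite mulr_ge0// ?ler0n// addr_ge0.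
have D0 : 0 < D by rewrite /D ltr_wpDl// !addr_ge0.
pose t := e / 2 / D.
have t0 : 0 < t by rewrite !divr_gt0.
have [g [ag _ Sg]] := test_section_approx r0 Kc hS SK t0.
set C := coord_comb c y0 r g in Sg.
have hC : test_section C by exact: (test_section_coord_comb r0 Kc).
pose Z := lincomb (-1) C S.
have hZ : test_section Z by exact: test_section_lincomb.
have SE : S = lincomb 1 Z C.
  by apply/funext => c'; apply/funext => x; rewrite /Z /lincomb scaleN1r scale1r addrC addNKr.
have ZK d x : ~ KM x -> Z d x = 0.
  by move=> xK; rewrite /Z /lincomb SK// /C (coord_comb_out (y0 := y0) (r := r))// scaler0 addr0.
have Zt x i j : KM x -> `|Z c x i j| <= t.
  by move=> Kx; rewrite !mxE mulN1r addrC; exact: Sg.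
have muC : (fun k => mu k C) @ \oo --> nu C.
  pose s p := sym_prod (coord_hd c (g p) p.1) (coord_hd c (bump y0 r) p.2).
  have ts p : test_section (s p) by exact: (test_section_coord_comb_term r0 Kc).
  have -> : (fun k => mu k C) = fun k => \sum_p mu k (s p).
    by apply/funext => k; exact: measure_sum.
  have -> : nu C = \sum_p nu (s p) by exact: measure_sum.
  apply: cvg_fin_sum => p; apply: mu_cvg; last exact: hE.
  exact: (admissible_hd r0 Kc).
have nuZ : `|nu Z| <= B * t by apply: nuB => //; exact: ltW.
have hZt : `|h Z| <= A * t by apply: hA => //; exact: ltW.
have muZ k : `|mu k Z + h Z| <= t * (N * P k).
  apply: (positive_bound r0 Kc (is_measureD (hmu k) hh)) => //.
  by move=> V hV; have := mu_lb k hV; lra.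
have De : t * D = e / 2 by rewrite /t divfK// gt_eqF.
near=> k.
have h1 : P k <= `|Q| + 1 by near: k.
have h2 : `|nu C - mu k C| <= e / 2.
  by near: k; have /cvgrPdist_le := muC; apply; rewrite divr_gt0.
rewrite SE (hnu.1 1 _ _ hZ hC) ((hmu k).1 1 _ _ hZ hC) !mul1r.
have -> : nu Z + nu C - (mu k Z + mu k C) =
  (nu C - mu k C) + (nu Z - (mu k Z + h Z) + h Z) by ring.
rewrite (le_trans (ler_normD _ _))// [leRHS]splitr lerD// -De.
rewrite (le_trans (ler_normD _ _))// (le_trans (lerD (ler_normB _ _) (lexx _)))//.
have := muZ k; have : t * (N * P k) <= t * (N * (`|Q| + 1)).
  by rewrite ler_pM2l// ler_wpM2l// ler0n.
rewrite /D; move: nuZ hZt; rewrite !(mulrC _ t) !mulrDr mulr1.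
set a := `|nu Z|; set b := `|h Z|; set v := `|_ + _|; lra.
Unshelve. all: by end_near. Qed.

(** Induction on the number of chart balls that cover the support: a cutoff splits
off a part supported in one chart and leaves a section that vanishes on the
first ball. *)
Lemma weak_cvg_global S : test_section S -> (fun k => mu k S) @ \oo --> nu S.
Proof.
have [c cP] := choice (@atlas_cover _ _ M).
have rP z : exists r : R, 0 < r /\ cball (coord_ (c z) z) (4 * r) `<=` im_ (c z).
  have [r r0 rc] := cball_in_chart (cP z); exists (r / 4).
  by split; [rewrite divr_gt0|rewrite mulrC divfK// pnatr_eq0].
have [r rz] := choice rP.
pose inner z := param_ (c z) @` cball (coord_ (c z) z) (r z).
suff main (l : seq M) T : test_section T ->
    (forall d x, T d x <> 0 -> exists2 z, z \in l & inner z x) ->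
    (fun k => mu k T) @ \oo --> nu T.
  move=> hS; have [[S0 _] _ _ cS] := hS.
  have [z _|l _ lS] := compact_finite_cover cS (U := inner).
    exact: nbhs_param_cball (cP z) (rz z).1.
  apply: (main l S) => // d x Sx; apply: lS; apply: subset_closure; exists d => //.
  by apply: contrapT => dx; apply: Sx; exact: S0.
elim: l T => [|z l ih] T hT TK.
  have -> : T = fun _ _ => 0.
    apply/funext => d; apply/funext => x; apply: contrapT => /TK[z].
    by rewrite in_nil.
  rewrite measure0//; under eq_fun do rewrite measure0//.
  exact: cvg_cst.
have [r0 Kc] := rz z.
have Kc2 : cball (coord_ (c z) z) (2 * r z) `<=` im_ (c z).
  by move=> y Ky; apply: Kc; apply: cballW Ky; rewrite ler_pM2r// ler_nat.
have Kc1 := subset_trans (cball_double r0) Kc2.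
(* f T lives in one chart; (1 - f) T vanishes on the first ball of the list. *)
pose f := bumpM (c z) (coord_ (c z) z) (r z).
have cf : continuous f by exact: continuous_bumpM.
have cf' : continuous (fun x => 1 - f x).
  by move=> x; apply: cvgB; [exact: cvg_cst|exact: cf].
have h1 := test_section_fun_mul cf hT.
have h2 := test_section_fun_mul cf' hT.
have TE : T = lincomb 1 (fun_mul f T) (fun_mul (fun x => 1 - f x) T).
  apply/funext => d; apply/funext => x; rewrite /lincomb /fun_mul scale1r.
  by rewrite scalerBl scale1r addrC subrK.
have muE k : mu k T = mu k (fun_mul f T) + mu k (fun_mul (fun x => 1 - f x) T).
  by rewrite {1}TE; have [-> // _] := hmu k; rewrite mul1r.
have nuE : nu T = nu (fun_mul f T) + nu (fun_mul (fun x => 1 - f x) T).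
  by rewrite {1}TE; have [-> // _] := hnu; rewrite mul1r.
rewrite nuE; under eq_fun do rewrite muE.
apply: cvgD.
  apply: (@weak_cvg_local (c z) (coord_ (c z) z) (2 * r z)) => //.
  - by rewrite mulr_gt0.
  - by rewrite mulrA -natrM.
  - by move=> d x xK; rewrite /fun_mul /f bumpM0// scale0r.
apply: ih => // d x; rewrite /fun_mul => Tx.
have [|w] := TK d x; first by move=> T0; apply: Tx; rewrite T0 scaler0.
rewrite in_cons => /predU1P[->|wl]; last by exists w.
by move=> xz; exfalso; apply: Tx; rewrite /f bumpM1// subrr scale0r.
Qed.

End weak_convergence.

(** * Convergence of integrals under uniform perturbation *)

(** Convergence to a finite limit of extended reals that are finite from some rank
on, in a form that adds up over finite sums. *)
Definition finite_cvg (R : realType) (u : nat -> \bar R) (l : \bar R) :=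
  exists2 a : R, l = a%:E &
    forall e : R, 0 < e -> \forall r \near \oo,
      exists2 b : R, u r = b%:E & `|a - b| <= e.

Section finite_cvg.
Variable R : realType.

Lemma finite_cvg_sum N (u : nat -> nat -> \bar R) (l : nat -> \bar R) :
  (forall k, (k < N)%N -> finite_cvg (u k) (l k)) ->
  finite_cvg (fun r => \sum_(0 <= k < N) u k r)%E (\sum_(0 <= k < N) l k)%E.
Proof.
elim: N => [|N ih] ul.
  exists 0; first by rewrite big_nil.
  move=> e e0; apply: nearW => r; exists 0; first by rewrite big_nil.
  by rewrite subrr normr0 ltW.
have [a aE ua] := ih (fun k kN => ul k (ltnW kN)).
have [b bE ub] := ul N (ltnSn N).
exists (a + b); first by rewrite big_nat_recr//= aE bE.
move=> e e0; have e20 : 0 < e / 2 by rewrite divr_gt0.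
apply: filterS2 (ua _ e20) (ub _ e20) => r [a' aE' aa'] [b' bE' bb'].
exists (a' + b'); first by rewrite big_nat_recr//= aE' bE'.
by rewrite opprD addrACA (le_trans (ler_normD _ _))// [leRHS]splitr lerD.
Qed.

Lemma nneseries_eventually0 (u : nat -> \bar R) N :
  (forall k, (N <= k)%N -> u k = 0%E) ->
  (\sum_(0 <= k <oo) u k)%E = (\sum_(0 <= k < N) u k)%E.
Proof.
move=> u0; apply: lim_near_cst => //.
exists N => // m /= Nm; rewrite (@big_cat_nat _ _ _ N)//= [X in (_ + X)%E]big1_seq ?adde0//.
by move=> k; rewrite mem_index_iota => /andP[_ /andP[Nk _]]; exact: u0.
Qed.

End finite_cvg.

Section integrable_real.
Context d (T : measurableType d) (R : realType) (m : {measure set T -> \bar R}).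
Implicit Types (D : set T) (f g : T -> R).

Lemma integrable_realD D f g : measurable D ->
  m.-integrable D (EFin \o f) -> m.-integrable D (EFin \o g) ->
  m.-integrable D (EFin \o (fun x => f x + g x)).
Proof. by move=> mD hf hg; exact: (integrableD mD hf hg). Qed.

Lemma integrable_realZ D (k : R) f : measurable D ->
  m.-integrable D (EFin \o f) -> m.-integrable D (EFin \o (fun x => k * f x)).
Proof. by move=> mD hf; exact: (integrableZl mD k hf). Qed.

Lemma integrable_realB D f g : measurable D ->
  m.-integrable D (EFin \o f) -> m.-integrable D (EFin \o g) ->
  m.-integrable D (EFin \o (fun x => f x - g x)).
Proof. by move=> mD hf hg; exact: (integrableB mD hf hg). Qed.

Lemma integrable_real_norm D f :
  m.-integrable D (EFin \o f) -> m.-integrable D (EFin \o (fun x => `|f x|)).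
Proof. by move=> hf; have := integrable_abse hf. Qed.

Lemma integrable_real_sum D (I : Type) (s : seq I) (f : I -> T -> R) :
  measurable D -> (forall i, m.-integrable D (EFin \o f i)) ->
  m.-integrable D (EFin \o (fun x => \sum_(i <- s) f i x)).
Proof.
move=> mD hf.
have -> : EFin \o (fun x => \sum_(i <- s) f i x) =
    fun x => (\sum_(i <- s) (EFin \o f i) x)%E.
  by apply/funext => x; rewrite /= sumEFin.
by apply: integrable_sum => // i _; exact: hf.
Qed.

Lemma integrable_setU A B (f : T -> \bar R) : measurable A -> measurable B ->
  m.-integrable A f -> m.-integrable B f -> m.-integrable (A `|` B) f.
Proof.
move=> mA mB /integrableP[mfA fA] /integrableP[mfB fB].
have mfU := (measurable_funU _ mA mB).2 (conj mfA mfB).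
have mBA : measurable (B `\` A) by exact: measurableD.
apply/integrableP; split => //.
have -> : A `|` B = A `|` (B `\` A).
  apply/seteqP; split=> x [?|]; [by left| |by left|by move=> []; right].
  by move=> Bx; have [?|?] := pselect (A x); [left|right].
rewrite ge0_integral_setU//=.
- rewrite lte_add_pinfty//; apply: le_lt_trans fB.
  by apply: ge0_subset_integral => //; exact: measurableT_comp.
- apply: measurableT_comp => //; apply: measurable_funS mfU.
    exact: measurableU.
  by move=> x [Ax|[Bx _]]; [left|right].
- by apply/disj_setPS => x [Ax [_]].
Qed.

Lemma integrable_finite_cover D (I : eqType) (s : seq I) (E : I -> set T)
    (f : T -> \bar R) :
  (forall i, measurable (E i)) -> measurable D ->
  (forall x, D x -> exists2 i, i \in s & E i x) ->
  (forall i, i \in s -> m.-integrable (D `&` E i) f) -> m.-integrable D f.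
Proof.
move=> mE mD; elim: s D mD => [|i s ih] D mD DE fE.
  have -> : D = set0 by apply/seteqP; split=> // x /DE[i]; rewrite in_nil.
  exact: integrable_set0.
have -> : D = (D `&` E i) `|` (D `\` E i) by rewrite setUIDK.
apply: integrable_setU.
- exact: measurableI.
- exact: measurableD.
- by apply: fE; rewrite mem_head.
- apply: ih; first exact: measurableD.
    move=> x [Dx Ex]; have [j] := DE _ Dx.
    by rewrite in_cons => /predU1P[-> //|js Ej]; exists j.
  move=> j js; apply: (@integrableS _ _ _ _ (D `&` E j)).
  - exact: measurableI.
  - by apply: measurableI => //; exact: measurableD.
  - by move=> x [[Dx _] Ejx].
  - by apply: fE; rewrite in_cons js orbT.
Qed.

(** The error is bounded by a small multiple of one integrable function, almost
everywhere; this also gives the integrability of [h r] for large [r]. *)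
Lemma finite_cvg_integral D (f g : T -> R) (h : nat -> T -> R) :
  measurable D -> m.-integrable D (EFin \o f) -> m.-integrable D (EFin \o g) ->
  (forall x, D x -> 0 <= g x) -> (forall r, measurable_fun D (h r)) ->
  (forall e : R, 0 < e -> e <= 1 -> \forall r \near \oo,
     \forall x \ae m, D x -> `|h r x - f x| <= e * g x) ->
  finite_cvg (fun r => \int[m]_(x in D) (h r x)%:E)%E
             (\int[m]_(x in D) (f x)%:E)%E.
Proof.
move=> mD hf hg g0 mh hfg.
have If : (\int[m]_(x in D) (f x)%:E)%E \is a fin_num.
  exact: integrable_fin_num.
have Ig : (\int[m]_(x in D) (g x)%:E)%E \is a fin_num.
  exact: integrable_fin_num.
exists (fine (\int[m]_(x in D) (f x)%:E)%E); first by rewrite fineK.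
move=> e e0; set G := fine (\int[m]_(x in D) (g x)%:E)%E.
have G0 : 0 <= G.
  by rewrite /G fine_ge0// integral_ge0// => x Dx; rewrite lee_fin g0.
(* chosen so that [e' * G <= e] and [e' <= 1] *)
pose e' := Num.min 1 (e / (G + 1)).
have G1 : 0 < G + 1 by rewrite ltr_wpDl.
have e'0 : 0 < e' by rewrite /e' lt_min ltr01 divr_gt0.
have e'1 : e' <= 1 by rewrite /e' ge_min lexx.
apply: filterS (hfg e' e'0 e'1) => r hr.
have mfr : measurable_fun D f by apply/measurable_EFinP; exact: measurable_int hf.
have mgr : measurable_fun D g by apply/measurable_EFinP; exact: measurable_int hg.
pose k x := h r x - f x.
have mk : measurable_fun D k by exact: measurable_funB.
have kle : (\int[m]_(x in D) `|(k x)%:E| <= (e' * G)%:E)%E.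
  rewrite EFinM /G fineK// -integralZl//.
  apply: ae_ge0_le_integral => //.
  - by apply/measurable_EFinP; exact: measurableT_comp.
  - by move=> x Dx; rewrite lee_fin mulr_ge0 ?g0// ltW.
  - by apply/measurable_EFinP; apply: measurable_funM.
have ik : m.-integrable D (EFin \o k).
  apply/integrableP; split; first exact/measurable_EFinP.
  by apply: le_lt_trans kle _; rewrite ltry.
have Ik : (\int[m]_(x in D) (k x)%:E)%E \is a fin_num.
  exact: integrable_fin_num.
exists (fine (\int[m]_(x in D) (f x)%:E)%E + fine (\int[m]_(x in D) (k x)%:E)%E).
  rewrite EFinD !fineK// -integralD//.
  by apply: eq_integral => x _; rewrite -EFinD /k addrC subrK.
rewrite opprD addrA subrr sub0r normrN.
rewrite -lee_fin (le_trans _ (le_trans kle _))//.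
  rewrite -fine_abse// fineK ?abse_fin_num//.
  by apply: le_abse_integral => //; exact/measurable_EFinP.
rewrite lee_fin (@le_trans _ _ (e / (G + 1) * G))//.
  by rewrite ler_wpM2r// /e' ge_min lexx orbT.
by rewrite mulrAC ler_pdivrMr// ler_pM2l// lerDl.
Qed.

End integrable_real.

(** * Charts and Lebesgue measure *)

Section chart_measure.
Variables (R : realType) (n : nat) (M : C11_manifold R n).
Local Notation RT := (measurableTypeR R).
Implicit Types (c d e : chart_index M) (x : M) (A B K : set M).
#[local] Opaque jac.

Lemma in_chartE c A (t : n.-tuple RT) :
  in_chart c A t <-> im_ c (row_of t) /\ A (param_ c (row_of t)).
Proof. by rewrite /in_chart coord_image_setI. Qed.

Lemma in_chartS c A B : A `<=` B -> in_chart c A `<=` in_chart c B.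
Proof. by move=> AB t /in_chartE[ct At]; apply/in_chartE; split=> //; exact: AB. Qed.

Lemma measurable_in_chart_open c (U : set M) : open U -> measurable (in_chart c U).
Proof. by move=> oU; apply: measurable_row_of_open; exact: open_coord_image. Qed.

Lemma compact_coord_image c K : compact K -> K `<=` dom_ c ->
  compact (coord_ c @` K).
Proof.
move=> cK Kc; apply: continuous_compact => //; apply: continuous_in_subspaceT => x.
by rewrite inE => /Kc; exact: coord_continuous_at.
Qed.

Lemma in_chart_compact c K : K `<=` dom_ c ->
  in_chart c K = @row_of R n @^-1` (coord_ c @` K).
Proof. by move=> Kc; rewrite /in_chart setIidr. Qed.

Lemma measurable_in_chart_compact c K : compact K -> K `<=` dom_ c ->
  measurable (in_chart c K).
Proof.
move=> cK Kc; rewrite in_chart_compact//; apply: measurable_row_of_closed.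
by apply: compact_closed; [exact: norm_hausdorff|exact: compact_coord_image].
Qed.

Lemma closed_of_compact K : compact K -> closed K.
Proof. by apply: compact_closed; exact: carrier_hausdorff. Qed.

(** The pieces are differences of compact sets inside the chart, and a compact set is
closed in the coordinates. *)
Lemma measurable_piece (cK : (nat -> chart_index M) * (nat -> set M)) k :
  chart_cover cK -> measurable (in_chart (cK.1 k) (seqDU cK.2 k)).
Proof.
move=> [Kd _]; set c := cK.1 k; set K := cK.2.
have -> : in_chart c (seqDU K k) = in_chart c (K k) `\`
    \bigcup_(j in [set j | (j < k)%N]) in_chart c (K k `&` K j).
  rewrite /seqDU -bigcup_mkord; apply/seteqP; split=> [t /in_chartE[ct [Kt nK]]|t].
    split; first exact/in_chartE.
    by move=> [j jk /in_chartE[_ [_ Kj]]]; apply: nK; exists j.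
  move=> [/in_chartE[ct Kt] nK]; apply/in_chartE; split=> //; split=> //.
  by move=> [j jk Kj]; apply: nK; exists j => //; apply/in_chartE.
apply: measurableD.
  by apply: measurable_in_chart_compact; [exact: (Kd k).1|exact: (Kd k).2].
apply: bigcup_measurable => j _; apply: measurable_in_chart_compact.
  apply: (subclosed_compact _ (Kd k).1); last exact: subIsetl.
  by apply: closedI; apply: closed_of_compact; [exact: (Kd k).1|exact: (Kd j).1].
by move=> x [/(Kd k).2].
Qed.

Lemma in_chart_cube c K : compact K -> K `<=` dom_ c ->
  exists C : R, in_chart c K `<=` @cube R n C.
Proof.
move=> cK Kc; have /compact_bounded[B [_ hB]] := compact_coord_image cK Kc.
exists (`|B| + 1) => t; rewrite in_chart_compact// => Kt j.
have := hB (`|B| + 1) _ _ Kt; rewrite (le_lt_trans (ler_norm _)) ?ltrDl// => /(_ isT).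
by apply: le_trans; rewrite (le_trans _ (ler_entry_norm _ 0 j))// mxE.
Qed.

Lemma chart_negligibleS c A B : A `<=` B -> chart_negligible c B -> chart_negligible c A.
Proof.
have [m mE _] := lebesgue_n_measure R n.
by rewrite /chart_negligible -mE => AB; apply: negligibleS; exact: in_chartS.
Qed.

Lemma chart_negligible0 c : chart_negligible c set0.
Proof.
have [m mE _] := lebesgue_n_measure R n.
rewrite /chart_negligible -mE (_ : in_chart c set0 = set0).
  exact: negligible_set0.
by apply/seteqP; split=> // t /in_chartE[].
Qed.

Lemma chart_negligibleU c A B :
  chart_negligible c A -> chart_negligible c B -> chart_negligible c (A `|` B).
Proof.
have [m mE _] := lebesgue_n_measure R n.
rewrite /chart_negligible -mE => hA hB.
apply: negligibleS (negligibleU hA hB) => t /in_chartE[ct [At|Bt]].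
  by left; apply/in_chartE.
by right; apply/in_chartE.
Qed.

Lemma chart_negligible_finite_cover c A (s : seq M) (U : M -> set M) :
  (forall x, A x -> exists2 z, z \in s & U z x) ->
  (forall z, z \in s -> chart_negligible c (A `&` U z)) -> chart_negligible c A.
Proof.
elim: s A => [|z s ih] A AU hA.
  by apply: chart_negligibleS (chart_negligible0 c) => x /AU[].
apply: (@chart_negligibleS _ _ ((A `&` U z) `|` (A `\` U z))).
  by rewrite setUIDK.
apply: chart_negligibleU; first by apply: hA; rewrite mem_head.
apply: ih => [x [Ax Ux]|w ws].
  have [w] := AU _ Ax; rewrite in_cons => /predU1P[->//|ws Uw].
  by exists w.
apply: (@chart_negligibleS _ _ (A `&` U w)); first by move=> x [[]].
by apply: hA; rewrite in_cons ws orbT.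
Qed.

Lemma chart_negligible_exists c (I : finType) (A : I -> set M) :
  (forall i, chart_negligible c (A i)) ->
  chart_negligible c [set x | exists i, A i x].
Proof.
move=> hA; suff h (l : seq I) : chart_negligible c [set x | exists2 i, i \in l & A i x].
  apply: chart_negligibleS (h (enum I)) => x [i Ax].
  by exists i => //; rewrite mem_enum.
elim: l => [|i l ih].
  by apply: chart_negligibleS (chart_negligible0 c) => x [i]; rewrite in_nil.
apply: chart_negligibleS (chart_negligibleU (hA i) ih) => x [k /=].
by rewrite in_cons => /predU1P[->|kl] xk; [left|right; exists k].
Qed.

Definition coord_vf c (y0 : 'rV[R]_n) (r : R) (i : 'I_n) : components M 'rV[R]_n :=
  chart_section (@tangent_act R n) c (fun y => bump y0 r y *: delta_mx 0 i).

Lemma lipschitz_coord_vf c y0 r i : 0 < r -> cball y0 (2 * r) `<=` im_ c ->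
  lipschitz_vector_field (coord_vf c y0 r i) /\ compact_support (coord_vf c y0 r i).
Proof.
move=> r0 Kc; apply: lipschitz_vector_field_chart_section Kc _ _.
- exact: compact_cball.
- by move=> y yK; rewrite bump0// scale0r.
- by move=> y; apply: loclipZ; [exact: loclip_bump|exact: loclip_cst].
Qed.

Lemma coord_vf_self c y0 r i x : 0 < r -> dom_ c x -> cball y0 r (coord_ c x) ->
  coord_vf c y0 r i c x = delta_mx 0 i.
Proof.
move=> r0 cx Kx; rewrite /coord_vf chart_section_self//.
  by rewrite bump1// scale1r.
exact: loclip_tangent_act.
Qed.

(** On the ball where the field [v] equals a coordinate field, the components of
[T(v)] are components of [T]. Finitely many balls cover [K]. *)
Lemma tensor_uniform_cvg0 (T : nat -> components M (tensor12 R n)) :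
  (forall v, lipschitz_vector_field v -> compact_support v ->
     Linfty_cvg0 (fun r => tensor_apply (T r) v)) ->
  forall c K (e : R), compact K -> K `<=` dom_ c -> 0 < e ->
  \forall r \near \oo, chart_negligible c
    [set x | K x /\ exists i j k, e < `|T r c x i j k|].
Proof.
move=> Tv c K e cK Kc e0.
have [s [r [rs sK]]] := finite_ball_cover cK Kc.
pose U z := [set x | ball (coord_ c z) (r z) (coord_ c x)].
have near_s (s' : seq M) : {subset s' <= s} -> \forall q \near \oo,
    forall z, z \in s' -> chart_negligible c
      [set x | (K `&` U z) x /\ exists i j k, e < `|T q c x i j k|].
  elim: s' => [|z s' ih] ss; first by apply: nearW.
  have [r0 Kc2] := rs z (ss z (mem_head z s')).
  have ss' : {subset s' <= s} by move=> w ws; apply: ss; rewrite in_cons ws orbT.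
  have hz : \forall q \near \oo, forall k, chart_negligible c
      [set x | K x /\ exists i j,
         e < `|tensor_apply (T q) (coord_vf c (coord_ c z) (r z) k) c x i j|].
    apply: filter_forall => k.
    have [lv cv] := @lipschitz_coord_vf c (coord_ c z) (r z) k r0 Kc2.
    exact: (Tv _ lv cv c K cK Kc e e0).
  apply: filterS2 (ih ss') hz => q h1 h2 w; rewrite in_cons => /predU1P[->|ws];
    last exact: h1.
  apply: chart_negligibleS (chart_negligible_exists h2).
  move=> x [[Kx Ux] [i [j [k eT]]]].
  exists k => //; split=> //; exists i, j; rewrite /tensor_apply mxE.
  rewrite (coord_vf_self _ r0 (Kc _ Kx) (ball_cball Ux)).
  rewrite (bigD1 k)//= big1 ?addr0; last first.
    by move=> l lk; rewrite mxE (negbTE lk) andbF mulr0.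
  by rewrite mxE !eqxx mulr1.
apply: filterS (near_s s (fun _ h => h)) => q hq.
apply: (@chart_negligible_finite_cover _ _ s U) => [x [Kx _]|z zs]; first exact: sK.
by apply: chart_negligibleS (hq z zs) => x [[Kx eT] Ux].
Qed.

End chart_measure.

(** * Christoffel symbols of a perturbed connection *)

Section christoffel.
Variables (R : realType) (n : nat) (M : C11_manifold R n).
Implicit Types (c d e : chart_index M) (x : M) (D : connection_map M)
  (T G : components M (tensor12 R n)).
#[local] Opaque jac.

Definition measurable_tensor T :=
  forall c i j k, chart_measurable c (fun x => T c x i j k).

Lemma add_tensorK D T : add_tensor (add_tensor D T) (fun c x => - T c x) = D.
Proof.
do 4!apply/funext => ?; rewrite /add_tensor -addrA -[RHS]addr0; congr (_ + _).
apply/rowP => i; rewrite !mxE -big_split big1// => j _ /=.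
by rewrite -big_split big1// => k _ /=; rewrite !ffunE !mxE !mulNr subrr.
Qed.

Lemma measurable_tensorN T : measurable_tensor T ->
  measurable_tensor (fun c x => - T c x).
Proof.
move=> mT c i j k; rewrite /chart_measurable.
have -> : (fun x => (- T c x) i j k) \o param_ c \o @row_of R n =
    (fun t => - ((fun x => T c x i j k) \o param_ c \o @row_of R n) t).
  by apply/funext => t; rewrite /= !ffunE mxE.
exact: measurableT_comp (mT c i j k).
Qed.

Lemma is_christoffel_add D T G : measurable_tensor T ->
  is_christoffel D G ->
  is_christoffel (add_tensor D T) (fun c x => G c x + T c x).
Proof.
move=> mT [mG hG]; split=> [c k j i|c O X Y i j oO Oc hX hY XO YO k].
  rewrite /chart_measurable.
  have -> : (fun x => (G c x + T c x) k j i) \o param_ c \o @row_of R n =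
      (fun t => ((fun x => G c x k j i) \o param_ c \o @row_of R n) t +
        ((fun x => T c x k j i) \o param_ c \o @row_of R n) t).
    by apply/funext => t; rewrite /= ffunE mxE.
  by apply: measurable_funD; [exact: mG|exact: mT].
apply: chart_negligibleS (hG c O X Y i j oO Oc hX hY XO YO k) => x [Ox ne].
split=> // DE; apply: ne; rewrite /add_tensor !ffunE !mxE DE; congr (_ + _).
rewrite XO// YO// (bigD1 j)//= (bigD1 i)//= !mxE !eqxx !mulr1.
rewrite big1 ?addr0 => [|l lj]; last by rewrite mxE (negbTE lj) andbF mulr0.
rewrite big1 ?addr0// => l lj; rewrite big1// => l' _.
by rewrite !mxE (negbTE lj) andbF mulr0 mul0r.
Qed.

(** [christoffel] is a choice with default value 0, so this requires existence. *)
Lemma christoffelP D : (exists G, is_christoffel D G) ->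
  is_christoffel D (christoffel D).
Proof. by move=> [G hG]; exact: (@xgetPex _ _ [set G | is_christoffel D G] (ex_intro _ G hG)). Qed.

Lemma measurable_christoffel D : measurable_tensor (christoffel D).
Proof.
have [h|h] := pselect (exists G, is_christoffel D G).
  by have [mG _] := christoffelP h.
have -> : christoffel D = fun _ _ => 0.
  by apply: xgetPN => G hG; apply: h; exists G.
move=> c i j k; rewrite /chart_measurable.
have -> : (fun x => (0 : tensor12 R n) i j k) \o param_ c \o @row_of R n = cst 0.
  by apply/funext => t; rewrite /= ffunE mxE.
exact: measurable_cst.
Qed.

(** On each of finitely many balls the symbols are tested on coordinate fields cut
off outside the ball. *)
Lemma is_christoffel_unique D G G' c (K : set M) :
  is_christoffel D G -> is_christoffel D G' -> compact K -> K `<=` dom_ c ->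
  chart_negligible c [set x | K x /\ exists i j k, G c x i j k <> G' c x i j k].
Proof.
move=> [_ hG] [_ hG'] cK Kc.
have [s [r [rs sK]]] := finite_ball_cover cK Kc.
pose U z := dom_ c `&` coord_ c @^-1` ball (coord_ c z) (r z).
apply: (@chart_negligible_finite_cover _ _ _ _ _ s U) => [x [Kx _]|z zs].
  by have [z zs xz] := sK _ Kx; exists z => //; split=> //; exact: Kc.
have [r0 Kc2] := rs z zs.
pose X i := coord_vf c (coord_ c z) (r z) i.
have hX i : lipschitz_vector_field (X i) by exact: (lipschitz_coord_vf i r0 Kc2).1.
have XU i x : U z x -> X i c x = delta_mx 0 i.
  by move=> [cx xz]; apply: coord_vf_self => //; exact: ball_cball.
have Uc : U z `<=` dom_ c by exact: subIsetl.
have bad k j i : chart_negligible c [set x | U z x /\ G c x k j i <> G' c x k j i].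
  have oU : open (U z) by exact: open_chart_ball.
  have h1 := hG c (U z) (X i) (X j) i j oU Uc (hX i) (hX j) (XU i) (XU j) k.
  have h2 := hG' c (U z) (X i) (X j) i j oU Uc (hX i) (hX j) (XU i) (XU j) k.
  apply: chart_negligibleS (chart_negligibleU h1 h2) => x [Ux ne].
  have [e1|e1] := pselect (D (X i) (X j) c x 0 k = G c x k j i); last by left.
  by right; split=> // e2; apply: ne; rewrite -e1 -e2.
have := chart_negligible_exists (fun k => chart_negligible_exists (fun j =>
  chart_negligible_exists (fun i => bad k j i))).
by apply: chart_negligibleS => x [[Kx [i [j [k ne]]]] Ux]; exists i, j, k.
Qed.

(** Adding a tensor is reversible, so the symbols exist for both connections or for
neither. In the latter case both choices take the default value. *)
Lemma christoffel_add_tensor D T : measurable_tensor T ->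
  christoffel (add_tensor D T) = christoffel D \/
  forall c (K : set M), compact K -> K `<=` dom_ c -> chart_negligible c
    [set x | K x /\ exists i j k, christoffel (add_tensor D T) c x i j k <>
       (christoffel D c x + T c x) i j k].
Proof.
move=> mT; have [h|h] := pselect (exists G, is_christoffel D G); [right|left].
  have h1 := is_christoffel_add mT (christoffelP h).
  have h2 : is_christoffel (add_tensor D T) (christoffel (add_tensor D T)).
    by apply: christoffelP; exists (fun c x => christoffel D c x + T c x).
  by move=> c K cK Kc; exact: is_christoffel_unique h2 h1 cK Kc.
have no D' : ~ (exists G, is_christoffel D' G) -> christoffel D' = fun _ _ => 0.
  by move=> h'; apply: xgetPN => G hG; apply: h'; exists G.
rewrite !no// => -[G hG]; apply: h.
exists (fun c x => G c x + - T c x).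
by rewrite -(add_tensorK D T); apply: is_christoffel_add => //; exact: measurable_tensorN.
Qed.

End christoffel.

(** * Local integrability of covariant derivatives *)

Section quadratic.
Variables (R : realType) (n : nat).
Implicit Types A B : 'I_n -> 'I_n -> R.

(** The integrand of Q, as a function of the two covariant derivatives. *)
Definition trace_form A B : R := \sum_i \sum_j (A i i * B j j - A i j * B j i).

Lemma trace_form_trivial A B : (n <= 1)%N -> trace_form A B = 0.
Proof.
move=> n1; rewrite /trace_form big1// => i _; rewrite big1// => j _.
have -> : j = i.
  have z0 (l : 'I_n) : val l = 0%N.
    by apply/eqP; rewrite -leqn0 -ltnS (leq_trans (ltn_ord l)).
  by apply/val_inj; rewrite !z0.
by rewrite subrr.
Qed.

Lemma product_perturbation (a b a' b' e : R) : 0 <= e <= 1 ->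
  `|a' - a| <= e -> `|b' - b| <= e ->
  `|a' * b' - a * b| <= e * (`|a| + `|b| + 1).
Proof.
move=> /andP[e0 e1] ha hb.
have -> : a' * b' - a * b = (a' - a) * (b' - b) + ((a' - a) * b + a * (b' - b)) by ring.
rewrite (le_trans (ler_normD _ _))//.
have h1 : `|(a' - a) * (b' - b)| <= e * 1.
  by rewrite normrM ler_pM// (le_trans hb).
have h2 : `|(a' - a) * b + a * (b' - b)| <= e * `|b| + `|a| * e.
  by rewrite (le_trans (ler_normD _ _))// !normrM lerD// ler_pM.
rewrite (le_trans (lerD h1 h2))// !mulrDr mulr1 (mulrC _ e).
by rewrite [leRHS]addrC lerD2l addrC.
Qed.

Definition trace_form_majorant A B : R :=
  \sum_i \sum_j ((`|A i i| + `|B j j| + 1) + (`|A i j| + `|B j i| + 1)).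

Lemma trace_form_perturbation A B A' B' (e : R) : 0 <= e <= 1 ->
  (forall i j, `|A' i j - A i j| <= e) -> (forall i j, `|B' i j - B i j| <= e) ->
  `|trace_form A' B' - trace_form A B| <= e * trace_form_majorant A B.
Proof.
move=> e01 hA hB; rewrite /trace_form /trace_form_majorant -sumrB mulr_sumr.
rewrite (le_trans (ler_norm_sum _ _ _))//; apply: ler_sum => i _.
rewrite -sumrB mulr_sumr (le_trans (ler_norm_sum _ _ _))//; apply: ler_sum => j _.
have -> : A' i i * B' j j - A' i j * B' j i - (A i i * B j j - A i j * B j i) =
  (A' i i * B' j j - A i i * B j j) - (A' i j * B' j i - A i j * B j i) by ring.
by rewrite (le_trans (ler_normB _ _))// mulrDr lerD//; exact: product_perturbation.
Qed.

(** The covariant derivatives of [f W] and of [W] differ by a matrix with one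
nonzero entry when [W] and [f] are a coordinate field and a coordinate function,
see [cov_deriv_coord_hd]. *)
Lemma trace_form_elementary A (a b : 'I_n) :
  trace_form A (fun i j => (i == b)%:R * (j == a)%:R) =
  (a == b)%:R * (\sum_i A i i) - A a b.
Proof.
rewrite /trace_form; under eq_bigr do rewrite sumrB.
rewrite sumrB; congr (_ - _).
  under eq_bigr do rewrite -mulr_sumr.
  rewrite -mulr_suml mulrC; congr (_ * _).
  rewrite (bigD1 b)//= big1 ?addr0; first by rewrite eqxx mul1r eq_sym.
  by move=> j /negbTE ->; rewrite mul0r.
rewrite (bigD1 a)//= [X in _ + X]big1 ?addr0; last first.
  by move=> i /negbTE ia; rewrite big1// => j _; rewrite ia mulr0 mulr0.
rewrite (bigD1 b)//= big1 ?addr0 ?eqxx ?mulr1//.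
by move=> j /negbTE ->; rewrite mul0r mulr0.
Qed.

End quadratic.

Section coordinate_derivative.
Variables (R : realType) (n : nat).

(** The derivative of the identity, read in one coordinate. *)
Lemma derive_coordinate (b : 'I_n) (v y : 'rV[R]_n) (k : R) :
  'D_v (fun z : 'rV[R]_n => z 0 b * k) y = v 0 b * k.
Proof.
have -> : (fun z : 'rV[R]_n => z 0 b * k) =
    (fun z : 'rV[R]_n => k *: ((fun w : 'rV[R]_n => w 0 b : R) z)).
  by apply/funext => z; rewrite mulrC.
have did : derivable (id : 'rV[R]_n -> 'rV[R]_n) y v by exact: derivable_id.
have db : derivable (fun w : 'rV[R]_n => w 0 b : R) y v.
  by move/derivable_mxP : did => /(_ 0 b).
rewrite deriveZ//; have := derive_mx did; rewrite derive_id => /matrixP/(_ 0 b).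
by rewrite mxE => <-; rewrite mulrC.
Qed.

End coordinate_derivative.

Section covariant_derivative.
Variables (R : realType) (n : nat) (M : C11_manifold R n).
Local Notation RT := (measurableTypeR R).
Implicit Types (c d e : chart_index M) (x : M) (D : connection_map M)
  (T G : components M (tensor12 R n)) (V W : components M 'rV[R]_n).
#[local] Opaque jac.

Lemma near_pderiv c i (f g : M -> R) x : dom_ c x -> (\near x, f x = g x) ->
  pderiv c i f x = pderiv c i g x.
Proof.
move=> cx fg; apply: near_eq_derive.
by have := nbhs_coord cx fg; apply: filterS => y [].
Qed.

Lemma cov_deriv_near0 G V c x i j : dom_ c x -> (\near x, V c x = 0) ->
  cov_deriv G V c x i j = 0.
Proof.
move=> cx V0; have Vx : V c x = 0 by exact: nbhs_singleton V0.
rewrite /cov_deriv Vx (@near_pderiv _ _ _ (fun=> 0) _ cx); last first.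
  by apply: filterS V0 => z ->; rewrite mxE.
rewrite /pderiv derive_cst big1 ?mxE ?mulr0 ?subr0 ?addr0//.
by move=> k _; rewrite mxE mulr0.
Qed.

(** The zeroth-order terms cancel, so the Christoffel symbols disappear and only the
derivative of the coordinate function is left. *)
Lemma cov_deriv_coord_hd G c y0 (r : R) (a b i j : 'I_n) y :
  cball y0 r `<=` im_ c -> ball y0 r y ->
  cov_deriv G (coord_hd c (fun y => bump y0 r y * y 0 b) a) c (param_ c y) i j
  - y 0 b * cov_deriv G (coord_hd c (bump y0 r) a) c (param_ c y) i j
  = (i == b)%:R * (j == a)%:R.
Proof.
move=> Kc yb.
have r0 : 0 < r by move: yb; rewrite -ball_normE/=; exact: le_lt_trans.
have Ky z : ball y0 r z -> cball y0 r z by exact: ball_cball.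
have cy := Kc _ (Ky _ yb).
have nyb : nbhs y (ball y0 r).
  by apply: open_nbhs_nbhs; split=> //; exact: ball_open.
have self g k z : ball y0 r z ->
    coord_hd c g k c (param_ c z) = g z *: delta_mx 0 k.
  by move=> /Ky/Kc cz; rewrite coord_hd_self ?paramK//; exact: param_dom.
rewrite /cov_deriv /pderiv paramK// !(self _ _ _ yb) (bump1 r0 (Ky _ yb)) mul1r scale1r.
have -> : 'D_(delta_mx 0 i) ((fun z => coord_hd c
     (fun y => bump y0 r y * y 0 b) a c z 0 j) \o param_ c) y = (i == b)%:R * (j == a)%:R.
  rewrite (@near_eq_derive _ _ _ _ (fun z : 'rV[R]_n => z 0 b * (j == a)%:R)).
    by rewrite derive_coordinate mxE eqxx eq_sym.
  apply: filterS nyb => z zb /=.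
  by rewrite self// (bump1 r0 (Ky _ zb)) mul1r !mxE.
have -> : 'D_(delta_mx 0 i) ((fun z => coord_hd c (bump y0 r) a c z 0 j)
     \o param_ c) y = 0.
  rewrite (@near_eq_derive _ _ _ _ (cst ((j == a)%:R : R))).
    by rewrite derive_cst.
  apply: filterS nyb => z zb /=.
  by rewrite self// (bump1 r0 (Ky _ zb)) scale1r !mxE eqxx.
have -> : \sum_k G c (param_ c y) j k i * (y 0 b *: delta_mx 0 a : 'rV[R]_n) 0 k =
    y 0 b * \sum_k G c (param_ c y) j k i * (delta_mx 0 a : 'rV[R]_n) 0 k.
  by rewrite mulr_sumr; apply: eq_bigr => k _; rewrite !mxE; ring.
rewrite !mxE; ring.
Qed.

Section integrability.
Variable m : {sigma_finite_measure set (n.-tuple RT) -> \bar R}.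
Hypothesis mE : (m : set (n.-tuple RT) -> \bar R) = @lebesgue_n R n.
Variables (D : connection_map M) (V : components M 'rV[R]_n).
Hypotheses (n1 : (1 < n)%N) (tD : tame D) (hV : lipschitz_half_density V).
Variables (cK : (nat -> chart_index M) * (nat -> set M)) (k : nat).
Hypothesis hcK : chart_cover cK.
Local Notation c := (cK.1 k).
Local Notation P := (in_chart (cK.1 k) (seqDU cK.2 k)).
Local Notation pt t := (param_ (cK.1 k) (row_of t)).
Local Notation A := (cov_deriv (christoffel D) V).

Let mP : measurable P. Proof. exact: measurable_piece. Qed.

Let mball (y0 : 'rV[R]_n) (r : R) : measurable (@row_of R n @^-1` ball y0 r).
Proof. by apply: measurable_row_of_open; exact: ball_open. Qed.

Lemma tame_integrable W : lipschitz_half_density W ->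
  m.-integrable P (EFin \o (fun t => Q_density D V W c (pt t))).
Proof. by move=> hW; rewrite mE; exact: (tD hV hW hcK).1. Qed.

Lemma lipschitz_coord_hd_bump y0 r a (g : 'rV[R]_n -> R) : 0 < r ->
  cball y0 (2 * r) `<=` im_ c -> (forall y, loclip g y) ->
  lipschitz_half_density (coord_hd c (fun y => bump y0 r y * g y) a).
Proof.
move=> r0 Kc lg; apply: (lipschitz_coord_hd a (@compact_cball _ _ y0 (2 * r)) Kc).
  by move=> y yK; rewrite bump0// mul0r.
by move=> y; apply: loclipM => //; exact: loclip_bump.
Qed.

(** Tameness for the half-densities [W] and [W'] with coefficients 1 and [y_b]
along the direction [a] near the centre: subtract [y_b] times the first integrand
from the second. The coordinate is bounded on the ball. *)
Lemma cov_deriv_integrable_combination y0 (r : R) a b : 0 < r ->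
  cball y0 (2 * r) `<=` im_ c -> cball y0 r `<=` im_ c ->
  m.-integrable (P `&` @row_of R n @^-1` ball y0 r) (EFin \o (fun t =>
    (a == b)%:R * (\sum_i A c (pt t) i i) - A c (pt t) a b)).
Proof.
move=> r0 Kc2 Kc1; set E := P `&` _.
have mEE : measurable E by exact: measurableI.
have EP : E `<=` P by exact: subIsetl.
pose W := coord_hd c (bump y0 r) a.
pose W' := coord_hd c (fun y => bump y0 r y * y 0 b) a.
have hW : lipschitz_half_density W.
  have := @lipschitz_coord_hd_bump y0 r a (fun=> 1) r0 Kc2.
  rewrite /W; under [X in coord_hd _ X]eq_fun do rewrite mulr1.
  by apply => y; exact: loclip_cst.
have hW' : lipschitz_half_density W'.
  apply: lipschitz_coord_hd_bump => // y.
  by have /loclip_mxP := @loclip_id R 'rV[R]_n y; apply.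
have i1 := integrableS mP mEE EP (tame_integrable hW).
have i2 := integrableS mP mEE EP (tame_integrable hW').
have mb : measurable_fun E (fun t : n.-tuple RT => (row_of t : 'rV[R]_n) 0 b).
  apply: measurable_funTS.
  have -> : (fun t : n.-tuple RT => (row_of t : 'rV[R]_n) 0 b) = (fun t => tnth t b).
    by apply/funext => t; rewrite mxE.
  exact: measurable_tnth.
have bb : [bounded (row_of t : 'rV[R]_n) 0 b : R | t in E].
  exists (`|y0| + r); split; first exact: num_real.
  move=> B rB t [_ /= tb]; rewrite (le_trans _ (ltW rB))//.
  rewrite (le_trans (ler_entry_norm _ 0 b))// -[row_of t](subrK y0) addrC.
  rewrite (le_trans (ler_normD _ _))// lerD2l.
  by move: tb; rewrite -ball_normE/= distrC => /ltW.
have i3 := integrableMr mEE mb bb i1.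
have i4 := integrableB mEE i2 i3.
apply: eq_integrable i4 => // t; rewrite inE => -[_ tb].
transitivity (Q_density D V W' c (pt t) - row_of t 0 b * Q_density D V W c (pt t))%:E => //.
rewrite /= -trace_form_elementary; congr EFin.
rewrite /Q_density -/(trace_form (A c (pt t)) _) -/(trace_form (A c (pt t)) _).
rewrite /trace_form mulr_sumr -sumrB; apply: eq_bigr => i _.
rewrite mulr_sumr -sumrB; apply: eq_bigr => j _.
by rewrite -!(cov_deriv_coord_hd (christoffel D) _ _ _ _ Kc1 tb) -/W -/W'; ring.
Qed.

(** Summing [cov_deriv_integrable_combination] over [a = b] gives [n - 1] times the
trace, and then each entry. This is where [1 < n] is used. *)
Lemma cov_deriv_integrable a b :
  m.-integrable P (EFin \o (fun t => A c (pt t) a b)).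
Proof.
have [Kc Kd] := hcK.1 k; set K := cK.2 k in Kc Kd.
have [s [r [rs sK]]] := finite_ball_cover Kc Kd.
apply: (@integrable_finite_cover _ _ _ m _ _ s
    (fun z => @row_of R n @^-1` ball (coord_ c z) (r z))) => //.
  move=> t /in_chartE[ct [Kt _]]; have [z zs zt] := sK _ Kt.
  by exists z => //; move: zt; rewrite /= paramK.
move=> z zs; have [r0 Kc2] := rs z zs.
have Kc1 := subset_trans (cball_double r0) Kc2.
set E := P `&` _; have mEE : measurable E by exact: measurableI.
have Eab a' b' := cov_deriv_integrable_combination a' b' r0 Kc2 Kc1.
have [ab|ab] := eqVneq a b; last first.
  have := integrable_realZ (-1) mEE (Eab a b).
  by apply: eq_integrable => // t _ /=; rewrite (negbTE ab) mul0r sub0r mulN1r opprK.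
pose tr t := \sum_i A c (pt t) i i.
have itr : m.-integrable E (EFin \o tr).
  have iS := integrable_real_sum (index_enum 'I_n) mEE (fun i => Eab i i).
  have := integrable_realZ (n%:R - 1)^-1 mEE iS.
  apply: eq_integrable => // t _ /=; congr EFin.
  rewrite sumrB -/(tr t) (eq_bigr (fun=> tr t)); last by move=> i _; rewrite eqxx mul1r.
  have -> : \sum_(i < n) tr t = n%:R * tr t by rewrite sumr_const card_ord mulr_natl.
  by field; rewrite subr_eq0 (eqr_nat R n 1) gtn_eqF.
have := integrable_realB mEE itr (Eab a b).
by apply: eq_integrable => // t _ /=; rewrite ab eqxx mul1r opprB addrC subrK.
Qed.

End integrability.

End covariant_derivative.

(** * Convergence of the quadratic forms *)

Section Q_convergence.
Variables (R : realType) (n : nat) (M : C11_manifold R n).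
Local Notation RT := (measurableTypeR R).
Implicit Types (c d e : chart_index M) (x : M)
  (G : components M (tensor12 R n)) (V W : components M 'rV[R]_n).
#[local] Opaque jac.

(** The change of the covariant derivative of [v] when the Christoffel symbols
change by [H]. *)
Definition cov_correction (H : tensor12 R n) (v : 'rV[R]_n) (i j : 'I_n) : R :=
  \sum_k H j k i * v 0 k - 2^-1 * (\sum_k H k k i) * v 0 j.

Lemma cov_deriv_sub G G' V c x i j :
  cov_deriv G' V c x i j - cov_deriv G V c x i j =
  cov_correction (G' c x - G c x) (V c x) i j.
Proof.
rewrite /cov_deriv /cov_correction.
have -> : \sum_k (G' c x - G c x) j k i * V c x 0 k =
    \sum_k G' c x j k i * V c x 0 k - \sum_k G c x j k i * V c x 0 k.
  by rewrite -sumrB; apply: eq_bigr => k _; rewrite !ffunE !mxE; ring.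
have -> : \sum_k (G' c x - G c x) k k i =
    \sum_k G' c x k k i - \sum_k G c x k k i.
  by rewrite -sumrB; apply: eq_bigr => k _; rewrite !ffunE !mxE.
by set p := pderiv _ _ _ _; ring.
Qed.

Lemma cov_correction_bound (H : tensor12 R n) (v : 'rV[R]_n) (B e : R) i j :
  0 <= e -> `|v| <= B -> (forall i j k, `|H i j k| <= e) ->
  `|cov_correction H v i j| <= e * (2 * n%:R * B).
Proof.
move=> e0 vB He; have B0 : 0 <= B by exact: le_trans vB.
have vk k : `|v 0 k| <= B by rewrite (le_trans (ler_entry_norm _ _ _)).
have h1 : `|\sum_k H j k i * v 0 k| <= n%:R * (e * B).
  rewrite (le_trans (ler_norm_sum _ _ _))//.
  have -> : n%:R * (e * B) = \sum_(k < n) e * B by rewrite sumr_const card_ord mulr_natl.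
  by apply: ler_sum => k _; rewrite normrM ler_pM.
have h2 : `|\sum_k H k k i| <= n%:R * e.
  rewrite (le_trans (ler_norm_sum _ _ _))//.
  have -> : n%:R * e = \sum_(k < n) e by rewrite sumr_const card_ord mulr_natl.
  by apply: ler_sum => k _.
rewrite /cov_correction (le_trans (ler_normB _ _))//.
have -> : e * (2 * n%:R * B) = n%:R * (e * B) + 1 * (n%:R * e) * B by ring.
rewrite lerD// !normrM ler_pM ?mulr_ge0// ler_pM//.
by rewrite ger0_norm ?invr_ge0// invf_le1// (ler_nat R 1 2).
Qed.

Variables (D : connection_map M) (T : nat -> components M (tensor12 R n)).
Hypothesis tD : tame D.
Hypothesis mT : forall r, measurable_tensor (T r).
Hypothesis T_cvg0 : forall v, lipschitz_vector_field v -> compact_support v ->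
  Linfty_cvg0 (fun r => tensor_apply (T r) v).
Local Notation D_ r := (add_tensor D (T r)).

(** By [christoffel_add_tensor] the difference is almost everywhere equal to [T r],
or it vanishes. *)
Lemma christoffel_uniform_cvg c (K : set M) (e : R) :
  compact K -> K `<=` dom_ c -> 0 < e ->
  \forall r \near \oo, chart_negligible c [set x | K x /\
    exists i j k, e < `|(christoffel (D_ r) c x - christoffel D c x) i j k|].
Proof.
move=> cK Kc e0.
have := tensor_uniform_cvg0 T_cvg0 cK Kc e0; apply: filterS => r hr.
have [->|h] := christoffel_add_tensor D (mT r).
  apply: chart_negligibleS (chart_negligible0 c) => x [_ [i [j [k]]]].
  by rewrite subrr ffunE mxE normr0 ltNge (ltW e0).
apply: chart_negligibleS (chart_negligibleU hr (h c K cK Kc)) => x.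
move=> [Kx [i [j [k H]]]].
have [E|E] := pselect (christoffel (D_ r) c x i j k =
    (christoffel D c x + T r c x) i j k); last by right; split=> //; exists i, j, k.
left; split=> //; exists i, j, k; move: H; congr (_ < `| _ |).
by move: E; rewrite !ffunE !mxE => ->; ring.
Qed.

Variables V W : components M 'rV[R]_n.
Hypotheses (hV : lipschitz_half_density V) (hW : lipschitz_half_density W).

Section piece.
Hypothesis n1 : (1 < n)%N.
Variables (cK : (nat -> chart_index M) * (nat -> set M)) (k : nat).
Hypothesis hcK : chart_cover cK.
Local Notation c := (cK.1 k).
Local Notation P := (in_chart (cK.1 k) (seqDU cK.2 k)).
Local Notation pt t := (param_ (cK.1 k) (row_of t)).

Lemma measurable_half_density U j : lipschitz_half_density U ->
  measurable_fun P (fun t => U c (pt t) 0 j).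
Proof.
move=> hU; apply: (@measurable_funS _ _ _ _ (@row_of R n @^-1` im_ c)).
- by apply: measurable_row_of_open; exact: coord_open.
- by move=> t /in_chartE[].
apply: (@open_continuous_measurable_row _ _ _ (fun y => U c (param_ c y) 0 j)).
  exact: coord_open.
move=> y cy; apply: continuous_entry; apply: loclip_continuous.
exact: half_density_loclip.
Qed.

Lemma measurable_christoffel_piece D' i j l :
  measurable_fun P (fun t => christoffel D' c (pt t) i j l).
Proof.
apply: (@measurable_funS _ _ _ _ (in_chart c setT)).
- by apply: measurable_in_chart_open; exact: openT.
- exact: in_chartS.
exact: (@measurable_christoffel _ _ _ D' c i j l).
Qed.

Lemma measurable_cov_correction U D1 D2 i j : lipschitz_half_density U ->
  measurable_fun P (fun t =>
    cov_correction (christoffel D1 c (pt t) - christoffel D2 c (pt t)) (U c (pt t)) i j).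
Proof.
move=> hU.
have mH a b l : measurable_fun P (fun t =>
    (christoffel D1 c (pt t) - christoffel D2 c (pt t)) a b l).
  have -> : (fun t => (christoffel D1 c (pt t) - christoffel D2 c (pt t)) a b l) =
      (fun t => christoffel D1 c (pt t) a b l - christoffel D2 c (pt t) a b l).
    by apply/funext => t; rewrite !ffunE !mxE.
  by apply: measurable_funB; exact: measurable_christoffel_piece.
have mU b := measurable_half_density b hU.
rewrite /cov_correction; apply: measurable_funB.
  by apply: measurable_sum => b; exact: measurable_funM.
by apply: measurable_funM => //; apply: measurable_funM => //; exact: measurable_sum.
Qed.

Lemma half_density_bounded U : lipschitz_half_density U ->
  exists2 B : R, 0 < B & forall x, cK.2 k x -> `|U c x| <= B.
Proof.
move=> hU; have [Kc Kd] := hcK.1 k.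
have [B B0 UB] : exists2 B : R, 0 < B & forall x, cK.2 k x -> `| `|U c x| | <= B.
  apply: continuous_compact_bounded => // x /Kd cx.
  apply: (@continuous_comp _ _ _ (U c) (fun v : 'rV[R]_n => `|v|)).
    exact: half_density_continuous.
  exact: norm_continuous.
by exists B => // x /UB; rewrite normr_id.
Qed.

(** The covariant derivatives are perturbed by a uniformly small amount, so the
integrand changes by a small multiple of [trace_form_majorant], which is
integrable by [cov_deriv_integrable] since the piece has finite measure. The
measurability of the original covariant derivatives is part of their
integrability, and the corrections involve no derivative. *)
Lemma Q_piece_cvg :
  finite_cvg (fun r => \int[@lebesgue_n R n]_(t in P) (Q_density (D_ r) V W c (pt t))%:E)%E
    (\int[@lebesgue_n R n]_(t in P) (Q_density D V W c (pt t))%:E)%E.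
Proof.
have [m mE mC] := lebesgue_n_measure R n; rewrite -mE.
have mP : measurable P by exact: measurable_piece.
pose A t := cov_deriv (christoffel D) V c (pt t).
pose B t := cov_deriv (christoffel D) W c (pt t).
have iA i j : m.-integrable P (EFin \o (fun t => A t i j)).
  exact: (cov_deriv_integrable mE n1 tD hV k hcK i j).
have iB i j : m.-integrable P (EFin \o (fun t => B t i j)).
  exact: (cov_deriv_integrable mE n1 tD hW k hcK i j).
have mA i j : measurable_fun P (fun t => A t i j).
  by apply/measurable_EFinP; exact: measurable_int (iA i j).
have mB i j : measurable_fun P (fun t => B t i j).
  by apply/measurable_EFinP; exact: measurable_int (iB i j).
have i1 : m.-integrable P (EFin \o (fun=> 1)).
  apply/integrableP; split; first exact: measurable_cst.
  have [Kc Kd] := hcK.1 k; have [C PC] := in_chart_cube Kc Kd.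
  rewrite /= normr1 integral_cst// mul1e (le_lt_trans _ (mC C))//.
  apply: le_measure; rewrite ?inE//; first exact: measurable_cube.
  by apply: subset_trans PC; apply: in_chartS; exact: subDsetl.
have [BV BV0 VB] := half_density_bounded hV.
have [BW BW0 WB] := half_density_bounded hW.
(* [cov_correction_bound] turns the bound [e / L] on the symbols into [e]. *)
pose L : R := 2 * n%:R * (BV + BW) + 1.
have L0 : 0 < L by rewrite ltr_wpDl// !mulr_ge0// addr_ge0// ltW.
apply: (@finite_cvg_integral _ _ _ m _ _ (fun t => trace_form_majorant (A t) (B t))) => //.
- exact: (tame_integrable mE tD hV k hcK hW).
- rewrite /trace_form_majorant.
  do 2![apply: integrable_real_sum => // ?].
  by do ![apply: integrable_realD => //]; exact: integrable_real_norm.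
- move=> t _; rewrite /trace_form_majorant.
  by do 2![apply: sumr_ge0 => ? _]; rewrite !addr_ge0.
- move=> r; rewrite /Q_density.
  have mr U i j : lipschitz_half_density U ->
      measurable_fun P (fun t => cov_deriv (christoffel D) U c (pt t) i j) ->
      measurable_fun P (fun t => cov_deriv (christoffel (D_ r)) U c (pt t) i j).
    move=> hU mU.
    have -> : (fun t => cov_deriv (christoffel (D_ r)) U c (pt t) i j) =
        (fun t => cov_deriv (christoffel D) U c (pt t) i j +
           cov_correction (christoffel (D_ r) c (pt t) - christoffel D c (pt t))
             (U c (pt t)) i j).
      by apply/funext => t; rewrite -cov_deriv_sub addrC subrK.
    by apply: measurable_funD => //; exact: measurable_cov_correction.
  do 2![apply: measurable_sum => ?].
  by apply: measurable_funB; apply: measurable_funM; apply: mr => //;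
    [exact: mA|exact: mB|exact: mA|exact: mB].
- move=> e e0 e1; have [Kc Kd] := hcK.1 k.
  have eL : 0 < e / L by rewrite divr_gt0.
  have := christoffel_uniform_cvg Kc Kd eL; apply: filterS => r.
  rewrite /chart_negligible -mE => hr.
  apply: negligibleS hr => t /= /not_implyP[Pt nt].
  have [ct [Kt nKt]] := (in_chartE _ _ _).1 Pt.
  apply/in_chartE; split=> //; split=> //.
  apply: contrapT => hs; apply: nt.
  have He i j l : `|(christoffel (D_ r) c (pt t) - christoffel D c (pt t)) i j l| <= e / L.
    by rewrite leNgt; apply/negP => h; apply: hs; exists i, j, l.
  have corr U (C : R) i j : 0 <= C -> C <= BV + BW -> `|U c (pt t)| <= C ->
      `|cov_deriv (christoffel (D_ r)) U c (pt t) i j -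
        cov_deriv (christoffel D) U c (pt t) i j| <= e.
    move=> C0 CB UC; rewrite cov_deriv_sub.
    rewrite (le_trans (cov_correction_bound i j (ltW eL) UC He))//.
    rewrite mulrAC ler_pdivrMr// ler_wpM2l ?(ltW e0)// /L.
    have : 2 * n%:R * C <= 2 * n%:R * (BV + BW) by rewrite ler_wpM2l// mulr_ge0.
    by move=> /le_trans; apply; rewrite lerDl.
  apply: trace_form_perturbation.
  + by rewrite (ltW e0).
  + by move=> i j; apply: (corr V BV); rewrite ?(ltW BV0)// ?lerDl ?(ltW BW0)//; exact: VB.
  + by move=> i j; apply: (corr W BW); rewrite ?(ltW BW0)// ?lerDr ?(ltW BV0)//; exact: WB.
Qed.

End piece.

Lemma Q_density_out D' c x : dom_ c x ->
  ~ closure [set x | exists2 c, dom_ c x & V c x <> 0] x ->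
  Q_density D' V W c x = 0.
Proof.
move=> cx nx.
have V0 : \near x, V c x = 0.
  have : nbhs x (~` closure [set x | exists2 c, dom_ c x & V c x <> 0]).
    by apply: open_nbhs_nbhs; split=> //; apply: closed_openC; exact: closed_closure.
  have := nbhs_dom cx; apply: filterS2 => z cz nz; apply: contrapT => Vz.
  by apply: nz; apply: subset_closure; exists c.
rewrite /Q_density big1// => i _; rewrite big1// => j _.
by rewrite !(cov_deriv_near0 _ _ _ cx V0) !mul0r subrr.
Qed.

(** Finitely many sets of the cover contain the support, and the later pieces are
disjoint from these sets. *)
Lemma cover_support_finite (cK : (nat -> chart_index M) * (nat -> set M)) :
  chart_cover cK -> exists N, forall D' k, (N <= k)%N ->
   (\int[@lebesgue_n R n]_(t in in_chart (cK.1 k) (seqDU cK.2 k))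
      (Q_density D' V W (cK.1 k) (param_ (cK.1 k) (row_of t)))%:E = 0)%E.
Proof.
move=> [_ hcK]; have [_ _ cV] := hV.
have [f hf] := choice hcK.
have [s _ sV] := @compact_finite_cover _ _ (fun z => cK.2 (f z)) cV (fun z _ => hf z).
exists (\max_(z <- s) f z).+1 => D' k Nk.
have [m mE _] := lebesgue_n_measure R n; rewrite -mE.
apply: integral0_eq => t /in_chartE[ct [_ nK]]; congr EFin.
apply: Q_density_out; first exact: param_dom.
move=> /sV[z zs Kz]; apply: nK; rewrite -bigcup_mkord; exists (f z) => //=.
by apply: leq_ltn_trans Nk; exact: leq_bigmax_seq.
Qed.

(** The integral over the manifold is a finite sum of integrals over pieces, each
treated by [Q_piece_cvg]. If there is no cover or if [n <= 1] all the forms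
coincide. *)
Lemma Q_form_cvg (a : R) (b : nat -> R) :
  Q_form D V W = a%:E -> (forall r, Q_form (D_ r) V W = (b r)%:E) ->
  b @ \oo --> a.
Proof.
move=> Qa Qb.
suff h : forall e : R, 0 < e -> \forall r \near \oo,
    exists2 b' : R, Q_form (D_ r) V W = b'%:E & `|a - b'| <= e.
  apply/cvgrPdist_le => e e0; apply: filterS (h e e0) => r [b'].
  by rewrite Qb => -[->].
have const : (forall r, Q_form (D_ r) V W = Q_form D V W) ->
    forall e : R, 0 < e -> \forall r \near \oo,
    exists2 b' : R, Q_form (D_ r) V W = b'%:E & `|a - b'| <= e.
  move=> QE e e0; apply: nearW => r; exists a; first by rewrite QE.
  by rewrite subrr normr0 ltW.
have [n1|n1] := leqP n 1.
  apply: const => r; rewrite /Q_form; congr density_integral.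
  apply/funext => c; apply/funext => x.
  by rewrite /Q_density -![LHS]/(trace_form _ _) -![RHS]/(trace_form _ _) !trace_form_trivial.
move: Qa const; rewrite /Q_form /density_integral.
case: pselect => [h|h] Qa const; last exact: const.
set cK := projT1 (cid h) in Qa const *; have hcK : chart_cover cK by exact: projT2 (cid h).
have [N hN] := cover_support_finite hcK.
have QN D' : density_integral_on cK (Q_density D' V W) = (\sum_(0 <= k < N)
    \int[@lebesgue_n R n]_(t in in_chart (cK.1 k) (seqDU cK.2 k))
      (Q_density D' V W (cK.1 k) (param_ (cK.1 k) (row_of t)))%:E)%E.
  by apply: nneseries_eventually0 => k; exact: hN.
have [a' a'E hc] := @finite_cvg_sum _ N _ _ (fun k _ => Q_piece_cvg n1 k hcK).
move: Qa; rewrite QN a'E => -[<-] e e0.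
by apply: filterS (hc e e0) => r; rewrite QN.
Qed.

End Q_convergence.

Unset Implicit Arguments.

Theorem proposition3p22 (R : realType) (n : nat) (M : C11_manifold R n)
    (nabla : connection_map M)
    (Ric : components M 'M[R]_n -> R)
    (T : nat -> components M (tensor12 R n))
    (Ricr : nat -> components M 'M[R]_n -> R) :
  is_connection nabla -> tame nabla ->
  (exists2 h, nonneg_measure h & satisfies_LB nabla h) ->
  ricci_measure nabla Ric ->
  (forall r, measurable_symmetric_tensor (T r)) ->
  (forall r v, lipschitz_vector_field v ->
     locally_bounded_components (tensor_apply (T r) v)) ->
  (exists2 h, nonneg_measure h &
     forall r, satisfies_LB (add_tensor nabla (T r)) h) ->
  (forall r, ricci_measure (add_tensor nabla (T r)) (Ricr r)) ->
  (forall v, lipschitz_vector_field v -> compact_support v ->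
     Linfty_cvg0 (fun r => tensor_apply (T r) v)) ->
  weak_star_cvg Ricr Ric.
Proof.
move=> _ tD _ [mRic QRic] mT _ [h [mh _] LB] RicrP Tcvg.
apply: (weak_cvg_global (h := h)) => //.
- by move=> r; exact: (RicrP r).1.
- by move=> r V hV; have := LB r V hV; rewrite (RicrP r).2// lee_fin.
- move=> V W hV hW.
  apply: (@Q_form_cvg _ _ _ nabla T tD _ Tcvg V W hV hW).
  + by move=> r; have [] := mT r.
  + exact: QRic.
  + by move=> r; exact: (RicrP r).2.
Qed.
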